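(* For each ordered continuum $\Lambda$, as $\vec{p}$ varies over all sequences of integers greater than $1$, the spaces $S(\Lambda,\vec{p})$ represent exactly $\mathfrak{c}$ many shapes and exactly $\mathfrak{c}$ many homeomorphism types.
   Context: $\mathfrak{c}=2^{\aleph_0}$. Shape: all spaces $X,Y$ are compact Hausdorff. Let $\mathcal{W}$ be the category whose objects are all spaces dominated (up to homotopy) by polyhedra and whose morphisms are homotopy classes of maps. For a space $X$, $\pi_X=[X,-]$ is the covariant functor from $\mathcal{W}$ to sets assigning to $W$ the set $[X,W]$ of homotopy classes of maps $X\to W$. A shape map from $X$ to $Y$ is a natural transformation $\Phi:\pi_Y\to\pi_X$; it is a shape equivalence if it is an invertible natural transformation (equivalently $\Phi:[Y,W]\to[X,W]$ is a bijection for every $W$ in $\mathcal{W}$). $X$ and $Y$ have the same shape if there is a shape equivalence from $X$ to $Y$. An ordered continuum is a nondegenerate compact connected space $\Lambda$ which has a linear order and whose topology is the order topology; $\partial\Lambda$ is the set consisting of its first and last points. For $n\ge 1$, $\Lambda^{(n)}=\Lambda_1\vee\dots\vee\Lambda_n$ denotes $n$ copies of $\Lambda$ laid end to end (the last point of $\Lambda_i$ is identified with the first point of $\Lambda_{i+1}$, orders preserved), and $\Sigma^{(n)}=\Lambda^{(n)}/\partial\Lambda^{(n)}$ is the ''circle'' obtained by identifying the first and last points of $\Lambda^{(n)}$; $\Sigma=\Sigma^{(1)}$. The identified endpoints of the copies of $\Lambda$ in $\Sigma^{(n)}$ are labeled in cyclic order $\infty_0,\dots,\infty_{n-1}$, and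 for $x\in\Lambda\setminus\partial\Lambda$, $\infty_i+x$ denotes the copy of $x$ in the $i$th copy of $\Lambda$ (the one starting at $\infty_i$). For positive integers $m,n$ the $m$-fold covering map $\phi^m_n:\Sigma^{(mn)}\to\Sigma^{(n)}$ is given by $\phi^m_n(\infty_i)=\infty_j$ and $\phi^m_n(\infty_i+x)=\infty_j+x$, where $j=i \bmod n$. For a sequence $\vec{p}=\langle p_1,p_2,\dots\rangle$ of positive integers, put $k(1)=1$ and $k(n)=p_1p_2\cdots p_{n-1}$ for $n>1$, and let $S(\Lambda,\vec{p})=\varprojlim\{\phi^{p_n}_{k(n)},\Sigma^{(k(n))},n\in\mathbb{N}\}$, the inverse limit with bonding maps $\phi^{p_n}_{k(n)}:\Sigma^{(k(n+1))}\to\Sigma^{(k(n))}$. *)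

(* Defs.v *)
From HB Require Import structures.
From Stdlib Require Import Relation_Definitions Relation_Operators.
From mathcomp Require Import all_boot all_order all_algebra.
From mathcomp Require Import generic_quotient finmap.
From mathcomp Require Import all_classical all_reals all_analysis.
From mathcomp Require Import lra.

Set Implicit Arguments.
Unset Strict Implicit.
Unset Printing Implicit Defensive.

Import Order.TTheory GRing.Theory Num.Theory.
Import numFieldNormedType.Exports.

Local Open Scope classical_set_scope.
Local Open Scope ring_scope.
Local Open Scope quotient_scope.

Lemma within_continuous_restr (T U V : topologicalType) (A : set U) (B : set T)
    (H : U -> V) (F : T -> U) (G : T -> V) :
  {within A, continuous H} -> {within B, continuous F} ->
  (forall x, B x -> A (F x)) -> (forall x, B x -> G x = H (F x)) ->
  {within B, continuous G}.
Proof.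
move=> /subspace_continuousP cH /subspace_continuousP cF BA GH.
apply/subspace_continuousP => x Bx W; rewrite /from_subspace (GH _ Bx) => nW.
have nF : nbhs x [set y | B y -> A (F y) -> W (H (F y))].
  exact: cF _ Bx _ (cH _ (BA x Bx) W nW).
apply: filterS nF => y /= HW By.
by rewrite GH//; exact: HW By (BA _ By).
Qed.

Section homotopy.
Context {R : realType} {X Y : topologicalType}.

Definition homotopic (f g : continuousType X Y) : Prop :=
  exists H : X * R -> Y,
    [/\ {within [set: X] `*` `[0, 1], continuous H},
        forall x, H (x, 0) = f x & forall x, H (x, 1) = g x].

Let reparam (h : R -> R) : continuous h ->
  forall A, {within A, continuous (fun z : X * R => (z.1, h z.2))}.
Proof.
move=> ch A; apply: continuous_subspaceT => z.
apply: (@cvg_pair _ _ _ (nbhs z) (nbhs z.1) (nbhs (h z.2))); first exact: cvg_fst.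
by apply: (@continuous_comp _ _ _ snd h); [exact: cvg_snd | exact: ch].
Qed.

Let closed_strip (a b : R) : closed ([set: X] `*` `[a, b]).
Proof.
have -> : [set: X] `*` `[a, b] = snd @^-1` `[a, b].
  by apply/seteqP; split=> [z []|z].
apply: preimage_closed; last exact: interval_closed.
by move=> z _; exact: cvg_snd.
Qed.

Lemma homotopic_refl f : homotopic f f.
Proof.
exists (f \o fst); split=> //; apply: continuous_subspaceT => z.
by apply: continuous_comp; [exact: cvg_fst | exact: cts_fun].
Qed.

Lemma homotopic_sym f g : homotopic f g -> homotopic g f.
Proof.
move=> [H [cH H0 H1]]; exists (fun z => H (z.1, 1 - z.2)); split.
- refine (within_continuous_restr (F := fun z : X * R => (z.1, 1 - z.2)) cH _ _ _) => //.
    apply: (@reparam (fun t => 1 - t)) => t.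
    by apply: cvgB; [exact: cvg_cst | exact: cvg_id].
  by move=> [x t] [_ /=]; rewrite !in_itv/= => /andP[? ?]; split=> //=; rewrite ?in_itv/=; lra.
- by move=> x /=; rewrite subr0.
- by move=> x /=; rewrite subrr.
Qed.

Lemma homotopic_trans f g k : homotopic f g -> homotopic g k -> homotopic f k.
Proof.
move=> [H [cH H0 H1]] [K [cK K0 K1]].
exists (fun z => if z.2 <= 2^-1 then H (z.1, 2 * z.2) else K (z.1, 2 * z.2 - 1)).
split=> [|x /=|x /=]; first last.
- by rewrite ifF; [rewrite -K1; congr K; congr pair; lra | apply/negbTE; lra].
- by rewrite ifT ?invr_ge0// mulr0.
have c2 : continuous (fun t : R => 2 * t).
  by move=> t; apply: cvgM; [exact: cvg_cst | exact: cvg_id].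
rewrite (_ : _ `*` _ = ([set: X] `*` `[0, 2^-1]) `|` ([set: X] `*` `[2^-1, 1])).
  apply: withinU_continuous; [exact: closed_strip | exact: closed_strip | |].
  - refine (within_continuous_restr (F := fun z : X * R => (z.1, 2 * z.2)) cH _ _ _).
    + exact: (@reparam (fun t => 2 * t)).
    + by move=> [x t] [_ /=]; rewrite !in_itv/= => /andP[? ?]; split=> //=; rewrite ?in_itv/=; lra.
    + by move=> [x t] [_ /=]; rewrite in_itv/= => /andP[_ ->].
  - refine (within_continuous_restr (F := fun z : X * R => (z.1, 2 * z.2 - 1)) cK _ _ _).
    + apply: (@reparam (fun t => 2 * t - 1)) => t.
      by apply: cvgB; [exact: c2 | exact: cvg_cst].
    + by move=> [x t] [_ /=]; rewrite !in_itv/= => /andP[? ?]; split=> //=; rewrite ?in_itv/=; lra.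
    + move=> [x t] [_ /=]; rewrite in_itv/= => /andP[t2 _].
      case: ifPn => // t2'; have -> : t = 2^-1 by apply/eqP; rewrite eq_le t2 t2'.
      by rewrite divff// subrr H1 K0.
apply/seteqP; split=> [[x t] [_ /=]|[x t] [] [_ /=]]; rewrite in_itv/= => /andP[t0 t1].
- by case: (leP t 2^-1) => t2; [left|right]; split=> //=; rewrite ?in_itv/=; lra.
- by split=> //=; rewrite ?in_itv/=; lra.
- by split=> //=; rewrite ?in_itv/=; lra.
Qed.

Definition homotopicb (f g : continuousType X Y) : bool := `[< homotopic f g >].

Let homotopicb_refl : reflexive homotopicb.
Proof. by move=> f; apply/asboolP/homotopic_refl. Qed.

Let homotopicb_sym : symmetric homotopicb.
Proof. by move=> f g; apply/asboolP/asboolP; exact: homotopic_sym. Qed.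

Let homotopicb_trans : transitive homotopicb.
Proof.
by move=> g f k /asboolP fg /asboolP gk; apply/asboolP/(homotopic_trans fg gk).
Qed.

Definition homotopic_equiv :=
  EquivRel homotopicb homotopicb_refl homotopicb_sym homotopicb_trans.

End homotopy.

(* [hclass R X Y] is the set [X, Y] of homotopy classes of maps. *)
Definition hclass (R : realType) (X Y : topologicalType) : Type :=
  {eq_quot (@homotopic_equiv R X Y)}.
HB.instance Definition _ (R : realType) (X Y : topologicalType) :=
  EqQuotient.on (hclass R X Y).

Section hclass_comp.
Context {R : realType} {X Y Z : topologicalType}.

(* Composition of homotopy classes; see [hcompE] for well-definedness. *)
Definition hcomp (h : hclass R Y Z) (u : hclass R X Y) : hclass R X Z :=
  \pi_(hclass R X Z) (repr h \o repr u : continuousType X Z).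

Lemma homotopic_comp (f f' : continuousType X Y) (g g' : continuousType Y Z) :
  @homotopic R _ _ f f' -> @homotopic R _ _ g g' ->
  @homotopic R _ _ (g \o f) (g' \o f').
Proof.
move=> [H [cH H0 H1]] [K [cK K0 K1]].
exists (fun z => K (H z, z.2)); split; last 2 first.
- by move=> x; rewrite H0 K0.
- by move=> x; rewrite H1 K1.
refine (within_continuous_restr (F := fun z : X * R => (H z, z.2)) cK _ _ _) => //.
  move=> z; apply: (@cvg_pair _ _ _ (nbhs z) (nbhs (H z)) (nbhs (z : X * R).2)).
    exact: cH.
  by apply: continuous_subspaceT => ?; exact: cvg_snd.
Qed.

Lemma hcompE (f : continuousType X Y) (g : continuousType Y Z) :
  hcomp (\pi_(hclass R Y Z) g) (\pi_(hclass R X Y) f) =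
  \pi_(hclass R X Z) (g \o f : continuousType X Z).
Proof.
apply/eqmodP/asboolP/homotopic_comp.
- by have /eqmodP/asboolP := reprK (\pi_(hclass R X Y) f).
- by have /eqmodP/asboolP := reprK (\pi_(hclass R Y Z) g).
Qed.

End hclass_comp.

(* An abstract simplicial complex on the vertex set [V]; vertices of [V] that
   belong to no simplex are allowed. *)
Record simplicial_complex (V : choiceType) := SimplicialComplex {
  simplex : set {fset V};
  simplex_neq0 : forall s, simplex s -> s != fset0;
  simplex_face : forall s t : {fset V},
    simplex s -> (t `<=` s)%fset -> t != fset0 -> simplex t }.

Section polyhedron.
Context {R : realType} {V : choiceType} (K : simplicial_complex V).

(* Barycentric coordinates of the points of the closed simplex [s]. *)
Definition closed_simplex (s : {fset V}) : set (V -> R) :=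
  [set x | [/\ forall v, 0 <= x v, forall v, v \notin s -> x v = 0 &
               \sum_(v <- s) x v = 1]].

Definition polyhedron : Type :=
  set_type (\bigcup_(s in simplex K) closed_simplex s).

HB.instance Definition _ := Choice.on polyhedron.

(* The weak (Whitehead) topology: a set is open iff its trace on every closed
   simplex is open for the Euclidean topology of that simplex, which is induced
   by the topology of pointwise convergence of the barycentric coordinates. *)
Definition polyhedron_open (U : set polyhedron) : Prop :=
  forall s, simplex K s -> exists2 O : set {ptws V -> R}, open O &
    forall x : polyhedron, closed_simplex s (val x) -> (U x <-> O (val x)).

Let polyhedron_openT : polyhedron_open [set: polyhedron].
Proof. by move=> s _; exists setT => //; exact: openT. Qed.

Let polyhedron_openI : setI_closed polyhedron_open.
Proof.
move=> A B oA oB s Ks.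
have [Q oQ AQ] := oA s Ks; have [P oP BP] := oB s Ks.
exists (Q `&` P); first exact: openI.
by move=> x xs; split=> [] [] /(AQ x xs) ? /(BP x xs) ?.
Qed.

Let polyhedron_open_bigU (I : Type) (f : I -> set polyhedron) :
  (forall i, polyhedron_open (f i)) -> polyhedron_open (\bigcup_i f i).
Proof.
move=> of_ s Ks.
have /choice [Q QP] : forall i, exists Q : set {ptws V -> R}, open Q /\
    forall x : polyhedron, closed_simplex s (val x) -> (f i x <-> Q (val x)).
  by move=> i; have [Q oQ fQ] := of_ i s Ks; exists Q.
exists (\bigcup_i Q i); first by apply: bigcup_open => i _; have [] := QP i.
by move=> x xs; split=> -[i _ /((QP i).2 x xs) ?]; exists i.
Qed.

HB.instance Definition _ := isOpenTopological.Build polyhedron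
  polyhedron_openT polyhedron_openI polyhedron_open_bigU.

End polyhedron.
Arguments polyhedron R {V} K.

Definition homotopy_dominated (R : realType) (P W : topologicalType) : Prop :=
  exists (f : continuousType W P) (g : continuousType P W),
    @homotopic R W W (g \o f) idfun.

(* Objects of the category of spaces dominated, up to homotopy, by polyhedra;
   its morphisms from [W] to [W'] are the elements of [hclass R W W']. *)
Record Wspace (R : realType) := WSpace {
  Wcarrier :> topologicalType;
  Wdominated : exists (V : choiceType) (K : simplicial_complex V),
    homotopy_dominated R (polyhedron R K) Wcarrier }.

(* A shape map from [X] to [Y]: a natural transformation [Y, -] -> [X, -]. *)
Record shape_map (R : realType) (X Y : topologicalType) := ShapeMap {
  shape_fun :> forall W : Wspace R, hclass R Y W -> hclass R X W;
  shape_natural : forall (W W' : Wspace R) (h : hclass R W W')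
    (u : hclass R Y W), @shape_fun W' (hcomp h u) = hcomp h (@shape_fun W u) }.
Arguments shape_fun {R X Y} s W u.

Definition shape_equivalence (R : realType) (X Y : topologicalType)
    (Phi : shape_map R X Y) : Prop :=
  exists Psi : shape_map R Y X, forall W : Wspace R,
    cancel (Phi W) (Psi W) /\ cancel (Psi W) (Phi W).

Definition same_shape (R : realType) (X Y : topologicalType) : Prop :=
  exists Phi : shape_map R X Y, shape_equivalence Phi.

Definition homeomorphic (X Y : topologicalType) : Prop :=
  exists (f : continuousType X Y) (g : continuousType Y X),
    cancel f g /\ cancel g f.

(* The topological quotient by the equivalence relation generated by [r]. *)
Section gluing.
Context {T : topologicalType} (r : T -> T -> Prop).

Definition gluing_rel (x y : T) : bool := `[< clos_refl_sym_trans T r x y >].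

Let gluing_refl : reflexive gluing_rel.
Proof. by move=> x; apply/asboolP; exact: rst_refl. Qed.

Let gluing_sym : symmetric gluing_rel.
Proof. by move=> x y; apply/asboolP/asboolP; exact: rst_sym. Qed.

Let gluing_trans : transitive gluing_rel.
Proof.
by move=> y x z /asboolP xy /asboolP yz; apply/asboolP/(rst_trans _ _ _ _ _ xy yz).
Qed.

Definition gluing_equiv := EquivRel gluing_rel gluing_refl gluing_sym gluing_trans.

Definition gluing : Type := quotient_topology {eq_quot gluing_equiv}.
HB.instance Definition _ := Topological.on gluing.
HB.instance Definition _ := Quotient.on gluing.

End gluing.

Section ordered_continuum.
Context {d : Order.disp_t} (L : orderTopologicalType d).

Definition ordered_continuum : Prop :=
  [/\ exists x y : L, x != y, compact [set: L] & connected [set: L]].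

Definition first_point (x : L) : Prop := forall y, (x <= y)%O.
Definition last_point (x : L) : Prop := forall y, (y <= x)%O.

(* In the disjoint union of copies of [L] indexed by ['I_n], the last point of
   the [i]th copy is identified with the first point of the copy [i + 1 mod n]
   ([ordS] is the cyclic successor). *)
Definition circle_rel (n : nat) (u v : {i : 'I_n & L}) : Prop :=
  [/\ last_point (projT2 u), first_point (projT2 v) &
      projT1 v = ordS (projT1 u)].

Definition circle (n : nat) : topologicalType := gluing (@circle_rel n).

Lemma copy_mod_subproof (m n : nat) (i : 'I_(m * n)) : (i %% n < n)%N.
Proof. by case: n i => [|n] i; [case: i => i; rewrite muln0 | rewrite ltn_pmod]. Qed.

Definition copy_mod (m n : nat) (u : {i : 'I_(m * n) & L}) : {i : 'I_n & L} :=
  existT _ (Ordinal (copy_mod_subproof (projT1 u))) (projT2 u).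

(* The [m]-fold covering map, computed on a representative of the class; it does
   not depend on the representative ([phiE]). *)
Definition phi (m n : nat) (c : circle (m * n)) : circle n :=
  \pi_(gluing (@circle_rel n)) (copy_mod (repr c)).

Lemma phiE (m n : nat) (u : {i : 'I_(m * n) & L}) :
  phi (\pi_(gluing (@circle_rel (m * n))) u) =
  \pi_(gluing (@circle_rel n)) (copy_mod u).
Proof.
rewrite /phi; set v := repr _.
have /eqmodP/asboolP : v = u %[mod gluing (@circle_rel (m * n))] by rewrite reprK.
move: v => v vu; apply/eqmodP/asboolP.
elim: vu => {u v} [u v [lu fv uv]|u|u v _|u v w _ uv _ vw].
- apply: rst_step; split=> //=; apply: val_inj => /=.
  rewrite uv /= modn_dvdm ?dvdn_mull//.
  by rewrite -addn1 -[in RHS]addn1 modnDml.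
- exact: rst_refl.
- exact: rst_sym.
- exact: rst_trans uv vw.
Qed.

Fixpoint kseq (p : nat -> nat) (n : nat) : nat :=
  if n is n'.+1 then (p n' * kseq p n')%N else 1%N.

Lemma kseqE (p : nat -> nat) (n : nat) : kseq p n = (\prod_(i < n) p i)%N.
Proof.
by elim: n => [|n IHn]; rewrite ?big_ord0// big_ord_recr/= -IHn mulnC.
Qed.

(* The inverse limit, as a subspace of the product. All sequences are indexed
   from 0, so that [kseq p n] is the product of the first [n] terms of [p]. *)
Definition solenoid (p : nat -> nat) : topologicalType :=
  set_type [set x : prod_topology (fun n => circle (kseq p n)) |
            forall n, phi (x n.+1) = x n].

End ordered_continuum.

(* For [r] an equivalence relation: the quotient set [D / r]. *)
Definition classes (T : Type) (D : set T) (r : T -> T -> Prop) : set (set T) :=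
  [set [set q | D q /\ r p q] | p in D].

(* Main.v *)
From HB Require Import structures.
From Stdlib Require Import Relation_Operators.
Require Import Defs.
From mathcomp Require Import all_boot all_order all_algebra.
From mathcomp Require Import generic_quotient finmap.
From mathcomp Require Import all_classical all_reals all_analysis.
From mathcomp Require Import ring lra zify.

Set Implicit Arguments.
Unset Strict Implicit.
Unset Printing Implicit Defensive.

Import Order.TTheory GRing.Theory Num.Theory.
Import numFieldNormedType.Exports.

Local Open Scope classical_set_scope.
Local Open Scope card_scope.
Local Open Scope ring_scope.
Local Open Scope quotient_scope.

(** Shape sees a solenoid through its homotopy classes of maps to the circle,
    that is through its first cohomology group, here the subgroup of the
    rationals generated by the fractions 1 / (p_0 ... p_(n-1)).  The invariant
    used is coarser: for a number q, whether every class of maps to the circle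
    is a q-th power.  The q-th power map of the circle acts by composition, so
    naturality alone makes this property a shape invariant
    ([powers_onto_shape]); no group structure has to be transported.  The
    property holds when q divides infinitely many p_n ([power_surjective]) and
    fails when q divides no product p_0 ... p_(n-1) ([winding_not_power]).
    Coding a set A of naturals by a sequence of primes in which the prime
    attached to i occurs infinitely often if i is in A, and never otherwise,
    gives continuum many shapes, hence continuum many homeomorphism types
    ([homeomorphic_same_shape]); there are no more because there are only
    continuum many sequences ([card_classes]).

    The circle is modelled by the punctured plane: it is dominated by the
    boundary of a square, and maps into it at an acute angle everywhere are
    homotopic by straight segments ([homotopic_dot]).

    The solenoid is the suspension of an odometer: [flow] maps the product of L
    with the compact space of digit sequences onto it, identifying the last
    point over j with the first point over j + 1.  Every map from this product
    to the punctured plane has a continuous argument ([product_lift]): along L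
    arguments are continued as along an interval ([lift_chain], which only uses
    that L is a connected linear order and serves again for the parameter of a
    homotopy), and the digit space is zero-dimensional.  The argument of a map
    on the solenoid therefore jumps by an integer c_j at the j-th seam.

    If q divides infinitely many p_n, the jumps are periodic with some period
    p_0 ... p_(n-1) such that q divides p_n, so their sum over the next period
    is divisible by q; dividing the accumulated argument by q then closes up
    and defines a q-th root on a finite stage, up to a small error at the last
    seam that is spread over a copy of L by a Urysohn function.

    Conversely let u wind once around each copy of L.  If u were homotopic to
    the q-th power of v, comparing arguments would give a continuous
    integer-valued function m on the product with
    m_(j+1) = m_j + 1 - q c_j; by continuity m takes the same value at 0 and at
    p_0 ... p_(n-1) for n large, whence q divides this product. *)

(** * Arguments of plane vectors *)

Section plane.
Context {R : realType}.
Implicit Types (z w : R * R) (s t : R).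

Definition cmul z w := (z.1 * w.1 - z.2 * w.2, z.1 * w.2 + z.2 * w.1).
Definition cconj z := (z.1, - z.2).
Definition cpow (q : nat) z := iter q (cmul z) (1, 0).

Definition dot z w := z.1 * w.1 + z.2 * w.2.

Definition cis (t : R) : R * R := (cos (2 * pi * t), sin (2 * pi * t)).

(** Arguments are measured in turns and are real numbers rather than classes
    modulo 1, so that a continuous choice of argument is a lift to the line. *)
Definition has_arg z t := exists2 r, 0 < r &
  z = (r * cos (2 * pi * t), r * sin (2 * pi * t)).

Lemma has_arg_mul z w s t :
  has_arg z s -> has_arg w t -> has_arg (cmul z w) (s + t).
Proof.
move=> [r r0 ->] [r' r'0 ->]; exists (r * r'); first exact: mulr_gt0.
by rewrite /cmul /= [2 * pi * (_ + _)]mulrDr cosD sinD; congr pair; ring.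
Qed.

Lemma has_arg_conj z t : has_arg z t -> has_arg (cconj z) (- t).
Proof.
by move=> [r r0 ->]; exists r => //; rewrite /cconj /= mulrN cosN sinN mulrN.
Qed.

Lemma has_arg1 : has_arg (1, 0) 0.
Proof. by exists 1 => //; rewrite mulr0 cos0 sin0 mulr1 mulr0. Qed.

Lemma has_arg_cpow q z t : has_arg z t -> has_arg (cpow q z) (q%:R * t).
Proof.
move=> zt; elim: q => [|q IHq]; first by rewrite mul0r; exact: has_arg1.
by rewrite -natr1 mulrDl mul1r addrC; exact: has_arg_mul.
Qed.

Lemma cis_nat t (n : nat) : cos (2 * pi * (t + n%:R)) = cos (2 * pi * t) /\
  sin (2 * pi * (t + n%:R)) = sin (2 * pi * t).
Proof.
elim: n => [|n [IHc IHs]]; first by rewrite addr0.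
have -> : 2 * pi * (t + n.+1%:R) = 2 * pi * (t + n%:R) + pi *+ 2.
  by rewrite -natr1; ring.
by rewrite mulr2n addrA cosDpi cosDpi sinDpi sinDpi !opprK.
Qed.

Lemma cis_int t (n : int) : cos (2 * pi * (t + n%:~R)) = cos (2 * pi * t) /\
  sin (2 * pi * (t + n%:~R)) = sin (2 * pi * t).
Proof.
case: (intP n) => [|k|k]; [by rewrite addr0 | exact: cis_nat |].
have [] := cis_nat (t + (- k.+1%:Z)%:~R) k.+1.
by rewrite rmorphN/= subrK => <- <-.
Qed.

Lemma has_arg_int z t (n : int) : has_arg z t -> has_arg z (t + n%:~R).
Proof. by move=> [r r0 ->]; exists r => //; have [-> ->] := cis_int t n. Qed.

Lemma cis_eq1 t : cos (2 * pi * t) = 1 -> exists n : int, t = n%:~R.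
Proof.
move=> ct; pose s := t - (Num.floor t)%:~R.
have s0 : 0 <= s by rewrite subr_ge0 floor_le_tmp.
have s1 : s < 1 by rewrite ltrBlDr addrC -intrD1 floorD1_gt.
have cs : cos (2 * pi * s) = 1.
  by have := (cis_int s (Num.floor t)).1; rewrite subrK ct => <-.
have [sz|sz] := eqVneq s 0.
  by exists (Num.floor t); apply/eqP; rewrite -subr_eq0 -/s sz.
have spi : 0 < sin (pi * s).
  have p0 := @pi_gt0 R; apply: sin_gt0_pi.
  by rewrite mulr_gt0 ?gtr_pMr//= lt_def sz.
have : cos (2 * pi * s) = 1 - sin (pi * s) ^+ 2 *+ 2.
  have -> : 2 * pi * s = (pi * s) *+ 2 by ring.
  by rewrite cos_mulr2n cos2sin2; ring.
rewrite cs => h; exfalso; have := exprn_gt0 2 spi; lra.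
Qed.

(** Two polar forms of z have the same radius, so the difference of their angles
    has cosine 1. *)
Lemma has_arg_uniq z s t : has_arg z s -> has_arg z t ->
  exists n : int, s - t = n%:~R.
Proof.
move=> [r r0 zE] /has_arg_conj [r' r'0 zE'].
apply: cis_eq1; rewrite mulrDr.
have n0 : 0 < cos (2 * pi * s) ^+ 2 + sin (2 * pi * s) ^+ 2.
  by rewrite cos2Dsin2.
have e : r' = r.
  have h1 : r' ^+ 2 = r ^+ 2.
    have /(congr1 (fun w => w.1 ^+ 2 + w.2 ^+ 2)) := zE'.
    rewrite zE /cconj /= sqrrN !exprMn -!mulrDr !cos2Dsin2; lra.
  by apply/eqP; rewrite -(eqrXn2 (n:=2)) ?ltW// h1.
move: zE'; rewrite zE /cconj /= e => -[].
move=> /(mulfI (lt0r_neq0 r0)) c; rewrite -mulrN => /(mulfI (lt0r_neq0 r0)) sn.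
by rewrite cosD -c -sn mulrN opprK -!expr2 cos2Dsin2.
Qed.

(** In the open right half-plane the argument can be chosen continuously. *)
Lemma has_arg_right z : 0 < z.1 -> has_arg z (atan (z.2 / z.1) / (2 * pi)).
Proof.
case: z => x y /= x0.
have p0 : 2 * pi != 0 :> R by rewrite mulf_neq0 ?gt_eqF ?pi_gt0.
have E : 2 * pi * (atan (y / x) / (2 * pi)) = atan (y / x).
  by rewrite mulrC divfK.
exists (x / cos (atan (y / x))).
  rewrite divr_gt0// cos_gt0_pihalf//.
  by rewrite atan_gtNpi2 atan_ltpi2.
have c0 : cos (atan (y / x)) != 0.
  by rewrite gt_eqF// cos_gt0_pihalf// atan_gtNpi2 atan_ltpi2.
rewrite E divfK//; congr pair.
have := atanK (y / x); rewrite /tan => h.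
rewrite -mulrA (mulrC _^-1) h; field; exact: lt0r_neq0.
Qed.

Lemma right_has_arg z t : has_arg z t -> `|t| < 4^-1 -> 0 < z.1.
Proof.
move=> [r r0 -> /=] /ltr_normlP[t1 t2]; rewrite mulr_gt0// cos_gt0_pihalf//.
have p := @pi_gt0 R.
have -> : 2 * pi * t = (pi / 2) * (4 * t) by field.
by rewrite -mulrN1 ltr_pM2l ?divr_gt0// gtr_pMr ?divr_gt0//; lra.
Qed.

Lemma has_arg_neq0 z t : has_arg z t -> z != 0.
Proof.
move=> [r r0 ->]; apply/eqP => -[] /eqP; rewrite mulf_eq0 gt_eqF//= => /eqP c0.
move=> /eqP; rewrite mulf_eq0 gt_eqF//= => /eqP s0.
by have := cos2Dsin2 (2 * pi * t); rewrite c0 s0 expr0n addr0 => /eqP; rewrite eq_sym oner_eq0.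
Qed.

Lemma has_arg_ex z : z != 0 -> exists t, has_arg z t.
Proof.
move=> z0.
have turn w t (h : has_arg w t) : has_arg (- w.2, w.1) (t + 4^-1).
  have [r r0 ->] := h; exists r => //=.
  have -> : 2 * pi * (t + 4^-1) = 2 * pi * t + pi / 2 by field.
  by rewrite cosDpihalf sinDpihalf mulrN.
have half w : (exists t, has_arg w t) -> exists t, has_arg (- w.2, w.1) t.
  by move=> [t /turn h]; eexists; exact: h.
have pos w : 0 < w.1 -> exists t, has_arg w t.
  by move=> /has_arg_right; exists (atan (w.2 / w.1) / (2 * pi)).
case: z z0 => x y; rewrite -pair_eqE /= negb_and => xy0.
have [x0|x0|x0] := ltrgtP x 0; last first.
- rewrite x0 eqxx /= in xy0; rewrite x0 in xy0 *.
  have [y0|y0|y0] := ltrgtP y 0; last by rewrite y0 eqxx in xy0.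
  + have := half _ (half _ (half _ (pos (- y, 0) _))).
    rewrite /= ?opprK ?oppr0; apply; lra.
  + by have := half _ (pos (y, 0) _); rewrite /= oppr0; apply.
- exact: pos.
- have := half _ (half _ (pos (- x, - y) _)).
  by rewrite /= !opprK; apply; lra.
Qed.
Lemma has_arg_scale c z t :
  has_arg (c * z.1, c * z.2) t -> 0 < c -> has_arg z t.
Proof.
move=> [r r0 [e1 e2]] c0; exists (r / c); first exact: divr_gt0.
rewrite [z]surjective_pairing; congr pair; apply: (mulfI (lt0r_neq0 c0)).
- by rewrite e1; field; exact: lt0r_neq0.
- by rewrite e2; field; exact: lt0r_neq0.
Qed.

Lemma dot_gt0 z : z != 0 -> 0 < dot z z.
Proof.
case: z => x y z0; rewrite /dot /= -!expr2 lt_def addr_ge0 ?sqr_ge0// andbT.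
by rewrite paddr_eq0 ?sqr_ge0// !sqrf_eq0 -pair_eqE /= in z0 *.
Qed.

Lemma dot_neq0 z w : 0 < dot z w -> w != 0.
Proof. by apply: contraTneq => ->; rewrite /dot /= !mulr0 addr0 ltxx. Qed.

Lemma cmul_conj_dot z w : (cmul z (cconj w)).1 = dot z w.
Proof. by rewrite /cmul /dot /=; ring. Qed.

Lemma cpow_neq0 (q : nat) z : z != 0 -> cpow q z != 0.
Proof. by move=> /has_arg_ex[t /(has_arg_cpow q)]; exact: has_arg_neq0. Qed.

Lemma has_arg_cis t : has_arg (cis t) t.
Proof. by exists 1 => //; rewrite !mul1r. Qed.

Lemma cis_neq0 t : cis t != 0.
Proof. exact: has_arg_neq0 (has_arg_cis t). Qed.

Lemma cisDint t (n : int) : cis (t + n%:~R) = cis t.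
Proof. by rewrite /cis; have [-> ->] := cis_int t n. Qed.

(** The argument of a quotient, cleared of its denominator. *)
Lemma has_arg_cancel z w s t :
  has_arg (cmul z (cconj w)) s -> has_arg w t -> has_arg z (s + t).
Proof.
move=> zs wt; have := has_arg_mul zs wt.
rewrite (_ : cmul _ _ = (dot w w * z.1, dot w w * z.2)).
  by move=> /has_arg_scale; apply; exact: dot_gt0 (has_arg_neq0 wt).
by rewrite /cmul /dot /=; congr pair; ring.
Qed.

End plane.

(** * Continuity of real and plane valued maps *)

Section continuity.
Context {X Y Z : topologicalType}.

Lemma pair_continuous (f : X -> Y) (g : X -> Z) :
  continuous f -> continuous g -> continuous (fun x => (f x, g x)).
Proof. by move=> cf cg x; apply: cvg_pair; [exact: cf | exact: cg]. Qed.

Lemma fst_continuous : continuous (@fst X Y).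
Proof. by move=> z; exact: cvg_fst. Qed.

Lemma snd_continuous : continuous (@snd X Y).
Proof. by move=> z; exact: cvg_snd. Qed.

Lemma comp_continuous (f : X -> Y) (g : Y -> Z) :
  continuous f -> continuous g -> continuous (g \o f).
Proof. by move=> cf cg x; apply: continuous_comp; [exact: cf | exact: cg]. Qed.

End continuity.

Lemma prod_topology_continuous (X : topologicalType) (I : Type)
    (T : I -> topologicalType) (f : X -> prod_topology T) :
  (forall i, continuous (fun x => f x i)) -> continuous f.
Proof.
move=> cf x; apply/cvg_sup => i U [V [[W oW <-] /= Wfx] /filterS]; apply.
by apply: cf; exact: open_nbhs_nbhs.
Qed.

Section real_continuity.
Context {R : realType} {X : topologicalType}.
Implicit Types f g : X -> R.

Lemma addf_continuous f g :
  continuous f -> continuous g -> continuous (fun x => f x + g x).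
Proof. by move=> cf cg x; apply: cvgD; [exact: cf | exact: cg]. Qed.

Lemma oppf_continuous f : continuous f -> continuous (fun x => - f x).
Proof. by move=> cf x; apply: cvgN; exact: cf. Qed.

Lemma mulf_continuous f g :
  continuous f -> continuous g -> continuous (fun x => f x * g x).
Proof. by move=> cf cg x; apply: cvgM; [exact: cf | exact: cg]. Qed.

Lemma absf_continuous f : continuous f -> continuous (fun x => `|f x|).
Proof. by move=> cf x; apply: cvg_norm; exact: cf. Qed.

Lemma maxf_continuous f g :
  continuous f -> continuous g -> continuous (fun x => Num.max (f x) (g x)).
Proof. by move=> cf cg; exact: max_fun_continuous. Qed.

Lemma minf_continuous f g :
  continuous f -> continuous g -> continuous (fun x => Num.min (f x) (g x)).
Proof. by move=> cf cg; exact: min_fun_continuous. Qed.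

Lemma invf_continuous f :
  (forall x, f x != 0) -> continuous f -> continuous (fun x => (f x)^-1).
Proof. by move=> f0 cf x; apply: cvgV => //; exact: cf. Qed.

End real_continuity.

Section plane_continuity.
Context {R : realType} {X : topologicalType}.
Implicit Types f g : X -> R * R.

Lemma fst_comp_continuous f : continuous f -> continuous (fun x => (f x).1).
Proof. by move=> cf; exact: (comp_continuous cf fst_continuous). Qed.

Lemma snd_comp_continuous f : continuous f -> continuous (fun x => (f x).2).
Proof. by move=> cf; exact: (comp_continuous cf snd_continuous). Qed.

Lemma cconj_continuous f : continuous f -> continuous (fun x => cconj (f x)).
Proof.
move=> cf; apply: pair_continuous; first exact: fst_comp_continuous.
by apply: oppf_continuous; exact: snd_comp_continuous.
Qed.

Lemma cmul_continuous f g :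
  continuous f -> continuous g -> continuous (fun x => cmul (f x) (g x)).
Proof.
move=> cf cg; have [f1 f2] := (fst_comp_continuous cf, snd_comp_continuous cf).
have [g1 g2] := (fst_comp_continuous cg, snd_comp_continuous cg).
apply: pair_continuous; apply: addf_continuous; try exact: mulf_continuous.
by apply: oppf_continuous; exact: mulf_continuous.
Qed.

Lemma cpow_continuous q f : continuous f -> continuous (fun x => cpow q (f x)).
Proof.
by move=> cf; elim: q => [|q IHq]; [exact: cst_continuous | exact: cmul_continuous].
Qed.

Lemma cis_continuous (f : X -> R) : continuous f ->
  continuous (fun x => cis (f x)).
Proof.
move=> cf; have c : continuous (fun x => 2 * pi * f x).
  by apply: mulf_continuous => //; exact: cst_continuous.
by apply: pair_continuous; [apply: (comp_continuous c (@continuous_cos R))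
  | apply: (comp_continuous c (@continuous_sin R))].
Qed.

End plane_continuity.

(** * The punctured plane *)

Section punctured_plane.
Context {R : realType}.

Definition punctured : topologicalType := set_type [set z : R * R | z != 0].

Lemma puncturedP (z : punctured) : set_val z != 0.
Proof. exact: set_mem (valP z). Qed.

Definition to_punctured (z : R * R) (z0 : z != 0) : punctured :=
  exist _ z (mem_set z0).

Lemma punctured_val_continuous : continuous (set_val : punctured -> R * R).
Proof. exact: initial_continuous. Qed.

Lemma to_punctured_continuous (X : topologicalType) (f : X -> R * R)
    (f0 : forall x, f x != 0) :
  continuous f -> continuous (fun x => to_punctured (f0 x)).
Proof. by move=> cf; apply: continuous_comp_initial; exact: cf. Qed.

(** Homotopies are total in their real parameter; clamping it makes them
    continuous, and constant outside the unit interval. *)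
Definition clamp (s : R) : R := Num.min 1 (Num.max 0 s).

Lemma clamp_itv s : 0 <= clamp s <= 1.
Proof. by rewrite /clamp le_min ge_min ler01 le_max lexx lexx. Qed.

Lemma clamp0 : clamp 0 = 0.
Proof. by rewrite /clamp maxxx min_r. Qed.

Lemma clamp1 : clamp 1 = 1.
Proof. by rewrite /clamp max_r// minxx. Qed.

Lemma clamp_continuous : continuous clamp.
Proof.
apply: minf_continuous; first exact: cst_continuous.
by apply: maxf_continuous; [exact: cst_continuous | move=> ?].
Qed.

(** The segment between two vectors at an acute angle avoids the origin. *)
Lemma homotopic_dot (X : topologicalType) (f g : continuousType X punctured) :
  (forall x, 0 < dot (set_val (f x)) (set_val (g x))) -> @homotopic R _ _ f g.
Proof.
move=> fg.
pose F (z : X * R) : R * R :=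
  ((1 - clamp z.2) * (set_val (f z.1)).1 + clamp z.2 * (set_val (g z.1)).1,
   (1 - clamp z.2) * (set_val (f z.1)).2 + clamp z.2 * (set_val (g z.1)).2).
have F0 z : F z != 0.
  apply: (@dot_neq0 _ (set_val (f z.1))).
  have -> : dot (set_val (f z.1)) (F z) =
      (1 - clamp z.2) * dot (set_val (f z.1)) (set_val (f z.1)) +
      clamp z.2 * dot (set_val (f z.1)) (set_val (g z.1)).
    by rewrite /dot /=; ring.
  have := fg z.1; have := dot_gt0 (puncturedP (f z.1)); have /andP[] := clamp_itv z.2.
  nra.
have cF : continuous F.
  have cc : continuous (fun z : X * R => clamp z.2).
    exact: (comp_continuous snd_continuous clamp_continuous).
  have cc' : continuous (fun z : X * R => 1 - clamp z.2).
    by apply: addf_continuous; [exact: cst_continuous | exact: oppf_continuous].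
  have cv (h : continuousType X punctured) :
      continuous (fun z : X * R => set_val (h z.1)).
    apply: (comp_continuous (f := fst) (g := fun x => set_val (h x))).
      exact: fst_continuous.
    exact: (comp_continuous (@cts_fun _ _ h) punctured_val_continuous).
  by apply: pair_continuous; apply: addf_continuous; apply: mulf_continuous => //;
    (exact: fst_comp_continuous || exact: snd_comp_continuous).
exists (fun z => to_punctured (F0 z)); split.
- by apply: continuous_subspaceT; exact: to_punctured_continuous.
- move=> x; apply: val_inj => /=; rewrite /F /= clamp0 subr0 !mul1r !mul0r !addr0.
  by rewrite -surjective_pairing.
- move=> x; apply: val_inj => /=; rewrite /F /= clamp1 subrr !mul1r !mul0r !add0r.
  by rewrite -surjective_pairing.
Qed.

End punctured_plane.
Arguments punctured : clear implicits.

(** * The punctured plane is dominated by a square *)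

Section square.
Context {R : realType}.

(** The vertex (i, s) is the unit vector of sign s on the i-th axis; a simplex
    contains no two opposite vertices, so that the polyhedron is the unit sphere
    of the l1 norm. *)
Definition vertex : choiceType := (bool * bool)%type.

Definition square_simplex (s : {fset vertex}) : Prop :=
  s != fset0 /\ forall a, ~~ (((a, true) \in s) && ((a, false) \in s)).

Lemma square_simplex_neq0 s : square_simplex s -> s != fset0.
Proof. by case. Qed.

Lemma square_simplex_face (s t : {fset vertex}) : square_simplex s ->
  (t `<=` s)%fset -> t != fset0 -> square_simplex t.
Proof.
move=> [_ sa] /fsubsetP ts t0; split=> // a.
by apply: contra (sa a) => /andP[/ts -> /ts ->].
Qed.

Definition square : simplicial_complex vertex :=
  SimplicialComplex square_simplex_neq0 square_simplex_face.

Definition edge (e : bool * bool) : {fset vertex} :=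
  [fset (false, e.1); (true, e.2)]%fset.

Lemma edge_simplex e : square_simplex (edge e).
Proof.
split; first by apply/fset0Pn; exists (false, e.1); rewrite !inE eqxx.
by move=> a; rewrite !inE !xpair_eqE; case: a; case: e => [[] []].
Qed.

Definition signed (b : bool) (x : R) := if b then x else - x.

Definition l1norm (z : R * R) : R := `|z.1| + `|z.2|.

Lemma l1norm_gt0 (z : R * R) : z != 0 -> 0 < l1norm z.
Proof.
case: z => x y; rewrite /l1norm /= -pair_eqE /= negb_and => /orP[x0|y0].
- by rewrite ltr_pwDl ?normr_gt0.
- by rewrite ltr_wpDl ?normr_gt0.
Qed.

(** The barycentric coordinates of the radial projection to the l1 sphere. *)
Definition bary (z : R * R) (v : vertex) : R :=
  Num.max 0 (signed v.2 (if v.1 then z.2 else z.1)) / l1norm z.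

Definition quadrant (e : bool * bool) : set (R * R) :=
  [set z | 0 <= signed e.1 z.1 /\ 0 <= signed e.2 z.2].

Lemma quadrant_ex z : exists e, quadrant e z.
Proof.
exists (0 <= z.1, 0 <= z.2); rewrite /quadrant /= /signed.
by split; case: ifPn => //; rewrite -ltNge; lra.
Qed.

Lemma bary_edge e (z : R * R) : z != 0 -> quadrant e z -> closed_simplex (edge e) (bary z).
Proof.
move=> z0 [e1 e2]; have nz := l1norm_gt0 z0; split.
- by move=> v; apply: divr_ge0; [rewrite le_max lexx | exact: ltW].
- case=> a b; rewrite !inE !xpair_eqE /bary /= => h; rewrite max_l ?mul0r//.
  by case: e e1 e2 h => [[] []] /= e1 e2; case: a; case: b => //= _; rewrite /signed in e1 e2 *; lra.
- have -> : edge e = ((true, e.2) |` [fset (false, e.1)])%fset.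
    by rewrite /edge fsetUC.
  rewrite big_fsetU1 ?inE//= big_seq_fset1 /bary /= -mulrDl !max_r//.
  rewrite /l1norm; case: e e1 e2 => [e1 e2] /= h1 h2.
  have n b x : 0 <= signed b x -> signed b x = `|x|.
    by case: b => /= h; [rewrite ger0_norm | rewrite ler0_norm -1?oppr_ge0].
  rewrite (n _ _ h1) (n _ _ h2) addrC divff//.
  by rewrite gt_eqF//; exact: l1norm_gt0.
Qed.

Lemma bary_polyhedron (z : R * R) : z != 0 ->
  bary z \in \bigcup_(s in simplex square) @closed_simplex R _ s.
Proof.
move=> z0; have [e ze] := quadrant_ex z; apply/mem_set; exists (edge e).
  exact: edge_simplex.
exact: bary_edge.
Qed.

Definition to_square (z : punctured R) : polyhedron R square :=
  exist (fun x => x \in _) _ (bary_polyhedron (puncturedP z)).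

Lemma bary_continuous :
  continuous (fun z : punctured R => bary (set_val z) : {ptws vertex -> R}).
Proof.
apply: prod_topology_continuous => -[a b].
have c1 := fst_comp_continuous (@punctured_val_continuous R).
have c2 := snd_comp_continuous (@punctured_val_continuous R).
suff : continuous (fun z : punctured R => bary (set_val z) (a, b) : R) by [].
rewrite /bary; apply: mulf_continuous.
  apply: maxf_continuous; first exact: cst_continuous.
  by case: a; case: b => //=; exact: oppf_continuous.
apply: invf_continuous => [z|]; first by rewrite gt_eqF ?l1norm_gt0 ?puncturedP.
by apply: addf_continuous; exact: absf_continuous.
Qed.

Lemma quadrant_closed e :
  closed [set z : punctured R | quadrant e (set_val z)].
Proof.
have c b (f : punctured R -> R) : continuous f -> closed [set z | 0 <= signed b (f z)].
  move=> cf; have -> : [set z | 0 <= signed b (f z)] =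
      (fun z => signed b (f z)) @^-1` [set x | 0 <= x] by [].
  apply: preimage_closed; last exact: closed_ge.
  by move=> z _; case: b => /=; [exact: cf | exact: oppf_continuous].
apply: closedI; apply: c; [apply: fst_comp_continuous | apply: snd_comp_continuous];
  exact: punctured_val_continuous.
Qed.

(** An open set of the polyhedron is only controlled on each closed simplex. The
    four closed quadrants are the preimages of the edges; near a point, a quadrant
    that misses it may be discarded, and on the others the coordinates decide. *)
Lemma to_square_continuous : continuous to_square.
Proof.
apply/continuousP => U oU; rewrite openE => z Uz.
suff near_edge e : \forall z' \near z, quadrant e (set_val z') -> U (to_square z').
  have h : \forall z' \near z, forall e, quadrant e (set_val z') -> U (to_square z').
    exact: filter_forall near_edge.
  rewrite /interior; apply: filterS h => z' h.
  by have [e /h] := quadrant_ex (set_val z').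
have [Q oQ UQ] := oU _ (edge_simplex e).
have UQz z' : quadrant e (set_val z') -> U (to_square z') <-> Q (bary (set_val z')).
  move=> /(bary_edge (puncturedP z')) h; exact: (UQ (to_square z')).
have [ez|nez] := pselect (quadrant e (set_val z)).
  have : nbhs z ((fun z : punctured R => bary (set_val z) : {ptws vertex -> R}) @^-1` Q).
    by apply: bary_continuous; apply: open_nbhs_nbhs; split => //; apply/UQz.
  by apply: filterS => z' /= Qz' /UQz ->.
have : open (~` [set z : punctured R | quadrant e (set_val z)]).
  by apply: closed_openC; exact: quadrant_closed.
by rewrite openE => /(_ z nez); apply: filterS => z' /= nz' /nz'.
Qed.

Definition from_square_val (p : polyhedron R square) : R * R :=
  (val p (false, true) - val p (false, false),
   val p (true, true) - val p (true, false)).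

Lemma from_square_neq0 p : from_square_val p != 0.
Proof.
have [s [s0 ss] [p0 pn ps]] := set_mem (valP p).
rewrite /from_square_val; move: (val p) p0 pn ps => x x0 xn xs {p}.
have z a : x (a, true) * x (a, false) = 0.
  have := ss a; rewrite negb_and => /orP[/xn|/xn] ->; [exact: mul0r | exact: mulr0].
apply/eqP => -[/eqP]; rewrite subr_eq0 => /eqP e1 /eqP; rewrite subr_eq0 => /eqP e2.
have x_eq0 v : x v = 0.
  case: v => [a b].
  have := z a; have e : x (a, true) = x (a, false) by case: a.
  rewrite e -expr2 => /eqP; rewrite sqrf_eq0 => /eqP h.
  by case: b; rewrite ?e.
by have := oner_eq0 R; rewrite -xs big1 ?eqxx.
Qed.

Definition from_square p : punctured R := to_punctured (from_square_neq0 p).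

Lemma coord_continuous v : continuous (fun p : polyhedron R square => val p v).
Proof.
apply/continuousP => U oU.
suff : polyhedron_open ((fun p : polyhedron R square => val p v) @^-1` U) by [].
move=> s _; exists [set x : {ptws vertex -> R} | U (x v)] => //.
move: oU; apply: open_comp => x _; exact: proj_continuous.
Qed.

Lemma from_square_continuous : continuous from_square.
Proof.
apply: to_punctured_continuous; apply: pair_continuous;
  by apply: addf_continuous; [| apply: oppf_continuous]; exact: coord_continuous.
Qed.

Lemma punctured_dominated : homotopy_dominated R (polyhedron R square) (punctured R).
Proof.
exists (mkcts to_square_continuous), (mkcts from_square_continuous).
suff acute (z : R * R) : z != 0 ->
    0 < dot (bary z (false, true) - bary z (false, false),
             bary z (true, true) - bary z (true, false)) z.
  by apply: homotopic_dot => z; exact: acute (puncturedP z).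
move=> z0; have n0 := l1norm_gt0 z0.
rewrite /bary /= -!mulrBl /signed.
have m (x : R) : Num.max 0 x - Num.max 0 (- x) = x.
  have [x0|x0] := leP 0 x.
    by rewrite (max_l (y := - x)) ?subr0//; lra.
  by rewrite (max_r (x := 0) (y := - x)) ?sub0r ?opprK//; lra.
rewrite !m; have := dot_gt0 z0; rewrite /dot /= => h.
by rewrite ![_ / _ * _]mulrAC -mulrDl divr_gt0.
Qed.

Definition punctured_Wspace : Wspace R :=
  WSpace (ex_intro _ vertex (ex_intro _ square punctured_dominated)).

End square.

(** * Continuous arguments along a connected linear order *)

Lemma connected_local_ind (T : topologicalType) (A : set T) (a : T) :
  connected [set: T] ->
  (forall x0 : T, exists2 N : set T, nbhs x0 N & forall x x', N x -> N x' -> A x -> A x') ->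
  A a -> forall x, A x.
Proof.
move=> cT Aloc Aa x; suff -> : A = setT by [].
apply: cT; first by exists a.
- exists A; last by rewrite setTI.
  rewrite openE => y Ay; have [N Ny NA] := Aloc y.
  have Ny1 := nbhs_singleton Ny.
  by apply: filterS Ny => z Nz; exact: NA Ay.
- exists A; last by rewrite setTI.
  rewrite -[A]setCK; apply: open_closedC; rewrite openE => y nAy.
  have [N Ny NA] := Aloc y.
  have Ny1 := nbhs_singleton Ny.
  by apply: filterS Ny => z Nz Az; apply: nAy; exact: NA Az.
Qed.

Section lifting.
Context {R : realType}.

Definition is_lift (T : topologicalType) (f : T -> R * R) (theta : T -> R) :=
  continuous theta /\ forall x, has_arg (f x) (theta x).

Lemma right_lift (T : topologicalType) (f : T -> R * R) :
  continuous f -> (forall x, 0 < (f x).1) -> exists theta, is_lift f theta.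
Proof.
move=> cf f0; exists (fun x => atan ((f x).2 / (f x).1) / (2 * pi)).
split=> [|x]; last exact: has_arg_right.
have c : continuous (fun x => (f x).2 / (f x).1).
  apply: mulf_continuous; first exact: snd_comp_continuous.
  apply: invf_continuous => [x|]; first by rewrite gt_eqF.
  exact: fst_comp_continuous.
apply: mulf_continuous; last exact: cst_continuous.
exact: (comp_continuous c (@continuous_atan R)).
Qed.

Lemma dot_continuous (T : topologicalType) (f g : T -> R * R) :
  continuous f -> continuous g -> continuous (fun x => dot (f x) (g x)).
Proof.
move=> cf cg; apply: addf_continuous; apply: mulf_continuous;
  (exact: fst_comp_continuous || exact: snd_comp_continuous).
Qed.

(** Compactness of Y makes the neighbourhood independent of y. *)
Lemma tube_dot (T Y : topologicalType) (F : T * Y -> R * R) (x0 : T) :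
  compact [set: Y] -> continuous F -> (forall z, F z != 0) ->
  exists2 N : set T, nbhs x0 N & forall x x' y, N x -> N x' -> 0 < dot (F (x, y)) (F (x', y)).
Proof.
move=> cY cF F0.
have /compact_near_coveringP cov := cY.
pose G (z : Y * (T * T)) := dot (F (z.2.1, z.1)) (F (z.2.2, z.1)).
have cG : continuous G.
  have c21 : continuous (fun z : Y * (T * T) => z.2.1).
    by apply: (comp_continuous (f := snd) (g := fst)); [exact: snd_continuous | exact: fst_continuous].
  have c22 : continuous (fun z : Y * (T * T) => z.2.2).
    by apply: (comp_continuous (f := snd) (g := snd)); exact: snd_continuous.
  by apply: dot_continuous;
    [apply: (comp_continuous (f := fun z : Y * (T * T) => (z.2.1, z.1)) (g := F))
    |apply: (comp_continuous (f := fun z : Y * (T * T) => (z.2.2, z.1)) (g := F))] => //;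
    apply: pair_continuous => //; exact: fst_continuous.
have [] := cov _ (nbhs (x0, x0)) (fun q y => 0 < G (y, q)) _.
  move=> y _; have : nbhs (y, (x0, x0)) (G @^-1` [set r | 0 < r]).
    apply: cG; apply: open_nbhs_nbhs; split; first exact: open_gt.
    exact: dot_gt0 (F0 _).
  by apply: filterS => -[].
move=> [U V] [/= Ux Vx] UV; exists (U `&` V); first exact: filterI.
by move=> x x' y [Ux1 _] [_ Vx']; exact: (UV (x, x')).
Qed.

Section chain.
Context {d : Order.disp_t} {L : orderTopologicalType d} {Y : topologicalType}.

(** Continuation of arguments: the set of the x for which F, frozen beyond x, has
    a continuous argument relative to its value at a is open and closed, because
    freezing at two nearby points changes F by an acute angle. The constancy
    conditions allow both an order with end points and the whole real line. *)
Lemma lift_chain (F : L * Y -> R * R) (a b : L) :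
  connected [set: L] -> compact [set: Y] -> continuous F ->
  (forall z, F z != 0) ->
  (forall t y, (t <= a)%O -> F (t, y) = F (a, y)) ->
  (forall t y, (b <= t)%O -> F (t, y) = F (b, y)) ->
  exists theta, is_lift (fun z => cmul (F z) (cconj (F (a, z.2)))) theta.
Proof.
move=> cL cY cF F0 Fa Fb.
pose Fx x (z : L * Y) := F (Order.min z.1 x, z.2).
have cFx x : continuous (Fx x).
  apply: (comp_continuous (f := fun z : L * Y => (Order.min z.1 x, z.2)) (g := F)) => //.
  apply: pair_continuous; last exact: snd_continuous.
  by apply: min_fun_continuous; [exact: fst_continuous | exact: cst_continuous].
pose A := [set x | exists theta, is_lift (fun z => cmul (Fx x z) (cconj (F (a, z.2)))) theta].
suff : A b.
  move=> [theta [ct ht]]; exists theta; split => // -[t y].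
  have := ht (t, y); rewrite /Fx /=; have [tb|bt] := leP t b => //.
  by rewrite -(Fb t y) ?ltW.
apply: (@connected_local_ind L A a cL); last first.
  exists (fun=> 0); split; first exact: cst_continuous.
  move=> [t y]; have -> : Fx a (t, y) = F (a, y).
    by rewrite /Fx /=; have [/Fa|] := leP t a.
  have [s hs] := has_arg_ex (F0 (a, y)).
  by rewrite -(subrr s); apply: has_arg_mul => //; exact: has_arg_conj.
move=> x0; have [N] := tube_dot x0 cY cF F0.
rewrite itv_nbhsE => -[i [oi x0i] iN] Ndot.
exists [set` i]; first by exists i.
move=> x x' ix ix' [theta [ct ht]].
have [|t|eta [ce he]] := @right_lift _ (fun z => cmul (Fx x' z) (cconj (Fx x z))).
- by apply: cmul_continuous => //; exact: cconj_continuous.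
- rewrite cmul_conj_dot /Fx; case: t => t y /=.
  have conv u v w : (u <= v <= w)%O -> u \in i -> w \in i -> v \in i.
    case: (i) => l r /andP[uv vw]; rewrite !itv_boundlr => /andP[lu _] /andP[_ wr].
    by rewrite (le_trans lu) ?bnd_simp// (le_trans _ wr) ?bnd_simp.
  have [tx|xt] := leP t x; have [tx'|xt'] := leP t x'.
  + exact: dot_gt0.
  + by apply: Ndot; apply: iN => //=; apply: (conv x' t x) => //; rewrite tx ltW.
  + by apply: Ndot; apply: iN => //=; apply: (conv x t x') => //; rewrite tx' ltW.
  + by apply: Ndot; apply: iN.
exists (fun z => theta z + eta z); split; first exact: addf_continuous.
move=> z; have := has_arg_mul (ht z) (he z).
rewrite (_ : cmul _ _ = (dot (Fx x z) (Fx x z) * (cmul (Fx x' z) (cconj (F (a, z.2)))).1,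
  dot (Fx x z) (Fx x z) * (cmul (Fx x' z) (cconj (F (a, z.2)))).2)).
  by move=> /has_arg_scale; apply=> //; apply: dot_gt0; exact: F0.
by rewrite /cmul /dot /=; congr pair; ring.
Qed.
End chain.
End lifting.

(** * Digit sequences *)

Section digits.
Variable p : nat -> nat.

(** Mixed radix expansions, least significant digit first: the inverse limit of
    the cyclic groups of order [kseq p n], with no compatibility condition to
    carry around. *)
Definition digits : topologicalType :=
  prod_topology (fun i => discrete_topology 'I_(p i)).
Implicit Types (k : digits) (n m : nat).

Lemma digits_compact : compact [set: digits].
Proof.
have := @tychonoff nat (fun i => discrete_topology 'I_(p i)) (fun i => setT) _.
rewrite (_ : [set f | _] = setT); last by apply/seteqP; split.
by apply=> i; apply: finite_compact; exact: (@finite_finset 'I_(p i)).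
Qed.

Definition agree n k k' := forall i, (i < n)%N -> k i = k' i.

Lemma agree_sym n k k' : agree n k k' -> agree n k' k.
Proof. by move=> h i /h. Qed.

Lemma agree_trans n k1 k2 k3 : agree n k1 k2 -> agree n k2 k3 -> agree n k1 k3.
Proof. by move=> h h' i ni; rewrite h ?h'. Qed.

Lemma agree_le m n k k' : (m <= n)%N -> agree n k k' -> agree m k k'.
Proof. by move=> mn h i im; apply: h; exact: leq_trans im mn. Qed.

Lemma near_agree n k : \forall k' \near k, agree n k k'.
Proof.
have F : Filter (nbhs k) := nbhs_filter k.
elim: n => [|n IHn]; first exact: (@filterE _ _ F).
have : \forall k' \near k, k' n = k n.
  have := @proj_continuous nat (fun i => discrete_topology 'I_(p i)) n k.
  by move=> /(_ [set k n]); apply; exact: discrete_set1.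
apply: filterS2 IHn => k' h e i.
by rewrite ltnS leq_eqVlt => /orP[/eqP ->//|/h].
Qed.

Lemma nbhs_agree k (V : set digits) : nbhs k V ->
  exists m, forall k', agree m k k' -> V k'.
Proof.
pose G := filter_from [set: nat] (fun m => [set k' | agree m k k']).
have GF : Filter G.
  apply: filter_from_filter; first by exists 0%N.
  move=> m n _ _; exists (maxn m n) => // k' h; split; apply: agree_le h.
    exact: leq_maxl.
  exact: leq_maxr.
have Gk : G --> k.
  apply/cvg_sup => i U [W [[Q oQ <-] /= Qk] /filterS]; apply.
  by exists i.+1 => // k' h /=; rewrite /proj -(h i).
by move=> /Gk[m _ h]; exists m.
Qed.

(** Uniform continuity, for the ultrametric structure of the digit space. *)
Lemma uniform_agree (R : realType) (T : topologicalType)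
    (h : T * (digits * digits) -> R) :
  compact [set: T] -> continuous h -> (forall t k, 0 < h (t, (k, k))) ->
  exists n, forall t k k', agree n k k' -> 0 < h (t, (k, k')).
Proof.
move=> cT ch h0.
have cTK : compact [set: T * digits].
  rewrite -setXTT; exact: compact_setX cT digits_compact.
have /compact_near_coveringP cov := cTK.
have [] := cov nat \oo (fun n z => forall k', agree n z.2 k' -> 0 < h (z.1, (z.2, k'))) _.
  move=> [t k] _.
  have : nbhs (t, (k, k)) (h @^-1` [set r | 0 < r]).
    apply: ch; apply: open_nbhs_nbhs; split; first exact: open_gt.
    exact: h0.
  move=> [[U V] [/= Ut [[V1 V2] [/= Vk1 Vk2] V12]] UV].
  have [m mV] := nbhs_agree (filterI Vk1 Vk2).
  exists ([set z | U z.1 /\ agree m k z.2], [set n | (m <= n)%N]).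
    split => /=; last exact: nbhs_infty_ge.
    exists (U, [set k' | agree m k k']); first by split => //; exact: near_agree.
    by move=> [].
  move=> [[t' k'] n] [/= [Ut' kk'] mn] k'' k'k''.
  apply: (UV (t', (k', k''))); split => //=; apply: V12; split => /=.
    by have [] := mV _ kk'.
  by have [] := mV _ (agree_trans kk' (agree_le mn k'k'')).
move=> n _ hn; exists n => t k k' kk'.
by have := hn n (leqnn n) (t, k) I k' kk'.
Qed.

Lemma agree_continuous (T Z : topologicalType) (f : T * digits -> Z) n :
  (forall t k k', agree n k k' -> f (t, k) = f (t, k')) ->
  (forall k, continuous (fun t => f (t, k))) -> continuous f.
Proof.
move=> fn cf [t k] W Wf; have := cf k t W Wf => Wt.
exists ([set t' | W (f (t', k))], [set k' | agree n k k']).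
  by split => //=; exact: near_agree.
by move=> [t' k'] [/= Wt' kk'] /=; rewrite -(fn _ _ _ kk').
Qed.

Lemma agree_locally (Z : topologicalType) (f : digits -> Z) n :
  (forall k k', agree n k k' -> f k = f k') -> continuous f.
Proof.
move=> fn k W /= Wf; have Wfk := nbhs_singleton Wf.
suff : nbhs k (f @^-1` W) by [].
by apply: filterS (near_agree n k) => k' kk' /=; rewrite -(fn _ _ kk').
Qed.

End digits.

Section digits_lift.
Context {R : realType} (p : nat -> nat).
Hypothesis p_gt0 : forall n, (0 < p n)%N.

Definition trunc n (k : digits p) : digits p :=
  fun i => if (i < n)%N then k i else Ordinal (p_gt0 i).

Lemma agree_trunc n k : agree n k (trunc n k).
Proof. by move=> i ni; rewrite /trunc ni. Qed.

Lemma trunc_agree n k k' : agree n k k' -> trunc n k = trunc n k'.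
Proof. by move=> h; apply: functional_extensionality_dep => i; rewrite /trunc; case: ifP => // /h. Qed.

(** After truncation to enough digits the map takes finitely many values and
    moves by an acute angle, so an arbitrary choice of the argument of each
    truncated value can be corrected continuously. *)
Lemma digits_lift (F : digits p -> R * R) : continuous F ->
  (forall k, F k != 0) -> exists theta, is_lift F theta.
Proof.
move=> cF F0.
have [|||n hn] := @uniform_agree p R (digits p) (fun z => dot (F z.2.1) (F z.2.2)).
- exact: digits_compact.
- have c2 := @snd_continuous (digits p) (digits p * digits p)%type.
  by apply: dot_continuous;
    [apply: (comp_continuous (g := fun z => F z.1) c2)
    |apply: (comp_continuous (g := fun z => F z.2) c2)];
    apply: (fun cf => comp_continuous cf cF); [exact: fst_continuous | exact: snd_continuous].
- by move=> t k; exact: dot_gt0.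
have cst (Z : topologicalType) (f : digits p -> Z) : 
  continuous (fun k => f (trunc n k)).
  by apply: (@agree_locally _ _ _ n) => k k' /trunc_agree ->.
have [||eta [ce he]] := @right_lift R _ (fun k => cmul (F k) (cconj (F (trunc n k)))).
- by apply: cmul_continuous => //; apply: cconj_continuous; exact: cst.
- move=> k; rewrite cmul_conj_dot; apply: (hn k k (trunc n k)); exact: agree_trunc.
have [arg argP] := choice (fun k => has_arg_ex (F0 k)).
exists (fun k => eta k + arg (trunc n k)); split.
  by apply: addf_continuous => //; exact: cst.
by move=> k; exact: has_arg_cancel (he k) (argP (trunc n k)).
Qed.

Lemma product_lift (d : Order.disp_t) (L : orderTopologicalType d)
    (F : L * digits p -> R * R) (a b : L) :
  connected [set: L] -> first_point a -> last_point b -> continuous F ->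
  (forall z, F z != 0) -> exists theta, is_lift F theta.
Proof.
move=> cL fa lb cF F0.
have [||| theta [ct ht]] := @lift_chain R d L (digits p) F a b cL _ cF F0.
- exact: digits_compact.
- by move=> t k ta; congr (F (_, _)); apply/eqP; rewrite eq_le ta fa.
- by move=> t k bt; congr (F (_, _)); apply/eqP; rewrite eq_le bt lb.
have cFa : continuous (fun k => F (a, k)).
  apply: (comp_continuous (f := fun k => (a, k)) (g := F)) => //.
  by apply: pair_continuous; [exact: cst_continuous | move=> ?].
have [//|eta [ce he]] := digits_lift cFa.
exists (fun z => theta z + eta z.2); split.
  by apply: addf_continuous => //; apply: (comp_continuous (g := eta) (@snd_continuous _ _)).
by move=> [t k]; exact: has_arg_cancel (ht (t, k)) (he k).
Qed.

End digits_lift.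

(** * Odometers and solenoids *)

Section radix.
Variable p : nat -> nat.
Hypothesis p_gt0 : forall n, (0 < p n)%N.

Lemma kseq_gt0 n : (0 < kseq p n)%N.
Proof. by elim: n => //= n IHn; rewrite muln_gt0 p_gt0. Qed.

Fixpoint digits_val n (k : digits p) : nat :=
  if n is n'.+1 then (digits_val n' k + (k n' : 'I_(p n')) * kseq p n')%N else 0.

Lemma digits_val_lt n k : (digits_val n k < kseq p n)%N.
Proof.
elim: n => //= n IHn; apply: (@leq_trans ((k n : 'I__).+1 * kseq p n)).
  by rewrite mulSn ltn_add2r.
by rewrite leq_mul2r ltn_ord orbT.
Qed.

Lemma digits_val_modn n k : digits_val n k = (digits_val n.+1 k %% kseq p n)%N.
Proof. by rewrite /= addnC modnMDl modn_small// digits_val_lt. Qed.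

Lemma eq_digits_val n k k' : agree n k k' -> digits_val n k = digits_val n k'.
Proof.
elim: n => //= n IHn h; rewrite IHn ?h//.
by apply: agree_le h.
Qed.

Lemma digits_val_inj n k k' : digits_val n k = digits_val n k' -> agree n k k'.
Proof.
elim: n => [_ i //|n IHn e i]; rewrite ltnS leq_eqVlt => /orP[/eqP ->|].
  apply: val_inj; have /(congr1 (fun x => x %/ kseq p n)%N) := e.
  by rewrite /= ![(digits_val n _ + _)%N]addnC !divnMDl ?kseq_gt0// !divn_small ?digits_val_lt// !addn0.
by apply: IHn; rewrite (digits_val_modn n k) (digits_val_modn n k') e.
Qed.

Definition digits_of_nat (j : nat) : digits p :=
  fun i => Ordinal (ltn_pmod (j %/ kseq p i) (p_gt0 i)).

Lemma digits_val_of_nat n j : digits_val n (digits_of_nat j) = (j %% kseq p n)%N.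
Proof.
elim: n => [|n IHn] /=; first by rewrite modn1.
rewrite IHn; set K := kseq p n.
rewrite {3}(divn_eq j K) {2}(divn_eq (j %/ K) (p n)) mulnDl -mulnA -addnA modnMDl.
have := digits_val_lt n.+1 (digits_of_nat j); rewrite /= IHn -/K addnC => h.
by rewrite [RHS]modn_small.
Qed.

Lemma agree_digits_val n k : agree n k (digits_of_nat (digits_val n k)).
Proof. by apply: digits_val_inj; rewrite digits_val_of_nat modn_small// digits_val_lt. Qed.

Lemma agree_of_nat n j j' : (j %% kseq p n = j' %% kseq p n)%N ->
  agree n (digits_of_nat j) (digits_of_nat j').
Proof. by move=> e; apply: digits_val_inj; rewrite !digits_val_of_nat. Qed.

End radix.

Section circles.
Context {d : Order.disp_t} {L : orderTopologicalType d} (a b : L).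
Hypotheses (fa : first_point a) (lb : last_point b) (ab : a != b).

Lemma first_uniq x : first_point x -> x = a.
Proof. by move=> fx; apply/eqP; rewrite eq_le fx fa. Qed.

Lemma last_uniq x : last_point x -> x = b.
Proof. by move=> lx; apply/eqP; rewrite eq_le lx lb. Qed.

Definition circle_pt (n i : nat) (ni : (i < n)%N) (t : L) : circle L n :=
  \pi_(gluing (@circle_rel _ L n)) (existT _ (Ordinal ni) t).

Lemma circle_pt_eq n i i' (ni : (i < n)%N) (ni' : (i' < n)%N) t :
  i = i' -> circle_pt ni t = circle_pt ni' t.
Proof. by move=> e; subst i'; rewrite (bool_irrelevance ni ni'). Qed.

Lemma circle_pt_last n i j (ni : (i < n)%N) (nj : (j < n)%N) :
  j = (i.+1 %% n)%N -> circle_pt ni b = circle_pt nj a.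
Proof.
move=> e; apply/eqmodP/asboolP/rst_step; split => //=.
exact: val_inj.
Qed.

(** The normal form of a point of a circle as an index and a point of L other
    than its last point. *)
Definition canon n (u : {i : 'I_n & L}) : nat * L :=
  if projT2 u == b then ((projT1 u).+1 %% n, a)%N else (val (projT1 u), projT2 u).

Lemma canon_lt n (u : {i : 'I_n & L}) : ((canon u).1 < n)%N.
Proof.
rewrite /canon; case: u => i t /=; case: ifP => _ //=.
by rewrite ltn_pmod// (leq_trans _ (ltn_ord i)).
Qed.

Lemma pi_canon n (u : {i : 'I_n & L}) :
  \pi_(gluing (@circle_rel _ L n)) u = circle_pt (canon_lt u) (canon u).2.
Proof.
move: (canon_lt u); rewrite /canon; case: u => i t /=.
case: ifP => /= [/eqP ->|_] h.
  have -> : existT (fun=> L) i b = existT _ (Ordinal (ltn_ord i)) b.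
    by congr existT; exact: val_inj.
  exact: circle_pt_last.
by rewrite /circle_pt; congr (\pi_ _ (existT _ _ _)); exact: val_inj.
Qed.

Lemma canon_eq n (u v : {i : 'I_n & L}) :
  \pi_(gluing (@circle_rel _ L n)) u = \pi_(gluing (@circle_rel _ L n)) v ->
  canon u = canon v.
Proof.
move=> /eqmodP/asboolP; elim=> {u v} [u v [lu fv uv]|u|u v _ ->|u v w _ -> _ ->]//.
by rewrite /canon (last_uniq lu) (first_uniq fv) eqxx (negbTE ab) uv.
Qed.

Lemma canon_copy_mod m n (u : {i : 'I_(m * n) & L}) :
  canon (copy_mod u) = ((canon u).1 %% n, (canon u).2)%N.
Proof.
rewrite /canon; case: u => i t /=; case: ifP => // _ /=.
by rewrite modn_dvdm ?dvdn_mull// -addn1 modnDml addn1.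
Qed.

Section solenoid_points.
Variable p : nat -> nat.
Hypothesis p_gt0 : forall n, (0 < p n)%N.

Definition flow_seq (z : L * digits p) :
    prod_topology (fun n => circle L (kseq p n)) :=
  fun n => circle_pt (digits_val_lt n z.2) z.1.

Lemma flow_seqP z : flow_seq z \in
  [set x : prod_topology (fun n => circle L (kseq p n)) |
     forall n, phi (x n.+1) = x n].
Proof.
apply/mem_set => n; rewrite /flow_seq /circle_pt phiE.
by congr (\pi_ _ (existT _ _ _)); apply: val_inj; rewrite [RHS]digits_val_modn.
Qed.

(** A copy of L runs over every digit sequence k; [flow_last] joins the copy over
    a natural number j to the copy over its successor. *)
Definition flow (z : L * digits p) : solenoid L p :=
  exist (fun x => x \in _) _ (flow_seqP z).

Definition stage n (x : solenoid L p) : circle L (kseq p n) := set_val x n.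

Lemma stage_continuous n : continuous (stage n).
Proof.
have c1 : continuous (set_val : solenoid L p -> _) by exact: initial_continuous.
exact: (comp_continuous c1 (@proj_continuous _ _ n)).
Qed.

Lemma flow_continuous : continuous flow.
Proof.
apply: continuous_comp_initial.
apply: (prod_topology_continuous (f := flow_seq)) => n.
apply: (@agree_continuous _ _ _ _ n) => [t k k' kk'|k].
  by apply: circle_pt_eq; exact: eq_digits_val.
apply: (comp_continuous (f := existT (fun=> L) (Ordinal (digits_val_lt n k)))
  (g := \pi_(gluing (@circle_rel _ L _)))).
  exact: existT_continuous.
exact: pi_continuous.
Qed.

Lemma flow_last j :
  flow (b, digits_of_nat p_gt0 j) = flow (a, digits_of_nat p_gt0 j.+1).
Proof.
apply: val_inj; apply: functional_extensionality_dep => n.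
by apply: circle_pt_last; rewrite !digits_val_of_nat -addn1 -[in RHS]addn1 modnDml.
Qed.

(** In normal form the stages of a point of the solenoid share the same point of
    L, and their indices are successive truncations of one digit sequence. *)
Lemma flow_surj x : exists z, flow z = x.
Proof.
pose u n := canon (repr (stage n x)).
have u_lt n : ((u n).1 < kseq p n)%N by exact: canon_lt.
have uS n : u n = ((u n.+1).1 %% kseq p n, (u n.+1).2)%N.
  rewrite /u -canon_copy_mod; apply: canon_eq; rewrite reprK.
  rewrite -[RHS]/(phi (stage n.+1 x)).
  by rewrite -[LHS](set_mem (valP x) n).
have k_lt n : ((u n.+1).1 %/ kseq p n < p n)%N.
  by rewrite ltn_divLR ?kseq_gt0//; exact: u_lt.
exists ((u 0%N).2, (fun n => Ordinal (k_lt n)) : digits p).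
set k := fun _ => _.
have t_eq n : (u n).2 = (u 0%N).2 by elim: n => // n <-; rewrite [in RHS]uS.
have kE n : digits_val n (k : digits p) = (u n).1.
  elim: n => [|n IHn].
    by have := u_lt 0%N; case: (u 0%N).1.
  by rewrite /= IHn (uS n) /= [RHS](divn_eq _ (kseq p n)) addnC.
apply: val_inj; apply: functional_extensionality_dep => n.
rewrite -[LHS]/(circle_pt (digits_val_lt n k) (u 0%N).2) -[RHS]/(stage n x) -[RHS]reprK.
by rewrite pi_canon -/(u n) t_eq; apply: circle_pt_eq.
Qed.

End solenoid_points.

Section circle_fun.
Context {n : nat} {Z : topologicalType} (g : 'I_n -> L -> Z).
Hypotheses (cg : forall i, continuous (g i))
  (gE : forall i, g i b = g (ordS i) a).

Definition circle_fun (c : circle L n) : Z := g (projT1 (repr c)) (projT2 (repr c)).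

Lemma circle_funE i t : circle_fun (\pi_(gluing (@circle_rel _ L n)) (existT _ i t)) = g i t.
Proof.
have gP (u v : {i : 'I_n & L}) : u = v %[mod gluing (@circle_rel _ L n)] ->
    g (projT1 u) (projT2 u) = g (projT1 v) (projT2 v).
  move=> /eqmodP/asboolP; elim=> {u v} [u v [lu fv uv]|u|u v _ ->|u v w _ -> _ ->]//.
  by rewrite (last_uniq lu) (first_uniq fv) uv.
by rewrite /circle_fun (gP _ (existT _ i t)) ?reprK.
Qed.

Lemma circle_fun_continuous : continuous circle_fun.
Proof.
apply/quotient_continuous.
have -> : circle_fun \o \pi_(gluing (@circle_rel _ L n)) = (fun u => g (projT1 u) (projT2 u)).
  by apply/funext => -[i t]; exact: circle_funE.
exact: sigT_continuous.
Qed.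

End circle_fun.
End circles.

(** * Ordered continua *)

Lemma ordered_continuum_ends (d : Order.disp_t) (L : orderTopologicalType d) :
  compact [set: L] -> [set: L] !=set0 ->
  (exists a : L, first_point a) /\ (exists b : L, last_point b).
Proof.
move=> cL [x0 _]; split.
- pose G := filter_from [set: L] (fun y => [set x : L | (x <= y)%O]).
  have GF : ProperFilter G.
    apply: filter_from_proper; last by move=> y _; exists y => /=.
    apply: filter_from_filter; first by exists x0.
    move=> y z _ _; exists (Order.min y z) => // x /=.
    by rewrite le_min => /andP[? ?]; split.
  (* a cluster point of the initial segments lies below all of them *)
  have [|c [_ cc]] := cL G GF; first exact: filterT.
  exists c => y; rewrite leNgt; apply/negP => yc.
  have [||x [/= xy yx]] := cc [set x | (x <= y)%O] [set x | (y < x)%O].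
  + by exists y.
  + have -> : [set x | (y < x)%O] = `]y, +oo[%classic.
      by apply/seteqP; split=> x /=; rewrite in_itv /= andbT.
    by apply: open_nbhs_nbhs; split; [exact: rray_open | rewrite /= in_itv /= yc].
  + by have := le_lt_trans xy yx; rewrite ltxx.
- pose G := filter_from [set: L] (fun y => [set x : L | (y <= x)%O]).
  have GF : ProperFilter G.
    apply: filter_from_proper; last by move=> y _; exists y => /=.
    apply: filter_from_filter; first by exists x0.
    move=> y z _ _; exists (Order.max y z) => // x /=.
    by rewrite ge_max => /andP[? ?]; split.
  have [|c [_ cc]] := cL G GF; first exact: filterT.
  exists c => y; rewrite leNgt; apply/negP => cy.
  have [||x [/= xy yx]] := cc [set x | (y <= x)%O] [set x | (x < y)%O].
  + by exists y.
  + have -> : [set x | (x < y)%O] = `]-oo, y[%classic.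
      by apply/seteqP; split=> x /=; rewrite in_itv.
    by apply: open_nbhs_nbhs; split; [exact: lray_open | rewrite /= in_itv /= cy].
  + by have := lt_le_trans yx xy; rewrite ltxx.
Qed.

Lemma continuum_parameter (R : realType) (d : Order.disp_t)
    (L : orderTopologicalType d) (a b : L) :
  compact [set: L] -> a != b ->
  exists theta : L -> R, [/\ continuous theta, forall t, 0 <= theta t <= 1,
    theta a = 0 & theta b = 1].
Proof.
move=> cL ab.
have nL : normal_space L by apply: compact_normal => //; exact: order_hausdorff.
have aT := hausdorff_accessible (@order_hausdorff _ L).
have cl (x : L) : closed [set x] by exact: accessible_closed_set1.
have us : uniform_separator [set a] [set b].
  apply: (proj1 (@normal_separatorP R L) nL); [exact: cl | exact: cl |].
  by apply/seteqP; split=> // x [/= -> e]; rewrite e eqxx in ab.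
exists (Urysohn [set a] [set b]); split.
- exact: Urysohn_continuous.
- by move=> t; have := @Urysohn_range L R [set a] [set b] _ (ex_intro2 _ _ t I erefl); rewrite /= in_itv.
- by apply: (Urysohn_sub0 us); exists a.
- by apply: (Urysohn_sub1 us); exists b.
Qed.

Lemma int_valued_const (R : realType) (T : topologicalType) (f : T -> R) :
  connected [set: T] -> continuous f -> (forall x, exists n : int, f x = n%:~R) ->
  forall x y, f x = f y.
Proof.
move=> cT cf fi x y.
apply: (@connected_local_ind T [set y | f x = f y] x cT) => // x0.
exists [set x | `|f x0 - f x| < 2^-1].
  have /cvgrPdist_lt := cf x0; apply; lra.
move=> x1 x2 /= h1 h2 ->.
have [n1 e1] := fi x1; have [n2 e2] := fi x2.
have : `|f x1 - f x2| < 1.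
  have -> : f x1 - f x2 = (f x0 - f x2) - (f x0 - f x1) by ring.
  apply: le_lt_trans (ler_normB _ _) _; lra.
rewrite e1 e2 -intrB -intr_norm (ltr_int R _ 1) => h.
by congr (_%:~R); move: h; lia.
Qed.

(** * Roots of maps from a solenoid to the punctured plane *)

Section power.
Context {R : realType}.

Definition power q : continuousType (punctured R) (punctured R) :=
  mkcts (@to_punctured_continuous R (punctured R) (fun z => cpow q (set_val z))
    (fun z => cpow_neq0 q (puncturedP z))
    (@cpow_continuous R _ q _ (@punctured_val_continuous R))).

End power.

Section divisibility.
Context {R : realType} {d : Order.disp_t} {L : orderTopologicalType d} (a b : L).
Hypotheses (fa : first_point a) (lb : last_point b) (ab : a != b).
Hypotheses (cnL : connected [set: L]) (cL : compact [set: L]).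
Variable p : nat -> nat.
Hypothesis p_gt0 : forall n, (0 < p n)%N.

Local Notation seam := (digits_of_nat p_gt0).

Lemma flow_lift (u : continuousType (solenoid L p) (punctured R)) :
  exists theta, is_lift (fun z => set_val (u (flow z))) theta.
Proof.
apply: (product_lift p_gt0 cnL fa lb) => [|z]; last exact: puncturedP.
have cu := comp_continuous (@cts_fun _ _ u) punctured_val_continuous.
exact: (comp_continuous (@flow_continuous _ L p) cu).
Qed.

(** The two sides of a seam are the same point of the solenoid, so the two
    values of a lift differ by an integer. *)
Lemma lift_jump (f : solenoid L p -> R * R) (theta : L * digits p -> R) :
  is_lift (fun z => f (flow z)) theta ->
  exists c : nat -> int,
    forall j, theta (b, seam j) = theta (a, seam j.+1) + (c j)%:~R.
Proof.
move=> [_ ht].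
suff /choice [c cE] : forall j, exists n : int,
    theta (b, seam j) - theta (a, seam j.+1) = n%:~R.
  by exists c => j; rewrite -cE; ring.
move=> j; apply: has_arg_uniq (ht _) _.
by rewrite (flow_last fa lb); exact: ht.
Qed.

Lemma uniform_lift (theta : L * digits p -> R) (e : R) : continuous theta ->
  0 < e -> exists n, forall t k k', agree n k k' ->
    `|theta (t, k) - theta (t, k')| < e.
Proof.
move=> ct e0.
have [|||n hn] := @uniform_agree p R L
    (fun z => e - `|theta (z.1, z.2.1) - theta (z.1, z.2.2)|).
- exact: cL.
- have c1 := @fst_continuous L (digits p * digits p)%type.
  have c2 := @snd_continuous L (digits p * digits p)%type.
  have c21 := comp_continuous c2 fst_continuous.
  have c22 := comp_continuous c2 snd_continuous.
  apply: addf_continuous; first exact: cst_continuous.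
  apply: oppf_continuous; apply: absf_continuous; apply: addf_continuous.
    exact: (comp_continuous (pair_continuous c1 c21) ct).
  by apply: oppf_continuous; exact: (comp_continuous (pair_continuous c1 c22) ct).
- by move=> t k; rewrite subrr normr0 subr0.
- by exists n => t k k' kk'; have := hn t k k' kk'; rewrite subr_gt0.
Qed.

Lemma sum_periodic (c : nat -> int) (K m : nat) :
  (forall j, c (j + K)%N = c j) ->
  \sum_(j < m * K) c j = (\sum_(j < K) c j) *+ m.
Proof.
move=> cK; have cKm i j : c (i * K + j)%N = c j.
  by elim: i => [|i IHi]; rewrite ?mul0n// mulSn -addnA addnC cK.
elim: m => [|m IHm]; first by rewrite mul0n big_ord0.
rewrite mulSn addnC big_split_ord /= IHm mulrSr; congr (_ + _).
by apply: eq_bigr => j _; rewrite cKm.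
Qed.

(** A root of u is sought among the maps factoring through stage n.+1, where n
    is so large that the lift of u hardly depends on the digits from the n-th on,
    and q divides [p n]. *)
Lemma power_surjective (q : nat) :
  (0 < q)%N -> (forall N, exists2 n, (N <= n)%N & (q %| p n)%N) ->
  forall u : continuousType (solenoid L p) (punctured R),
  exists v : continuousType (solenoid L p) (punctured R),
    @homotopic R _ _ (power q \o v) u.
Proof.
move=> q0 qp u.
have [ut [cut hut]] := flow_lift u.
have [c cE] := lift_jump (f := fun x => set_val (u x)) (conj cut hut).
have e0 : 0 < 8^-1 :> R by lra.
have [n0 un0] := uniform_lift cut e0.
have [n n0n qpn] := qp n0.
have un m t k k' : (n <= m)%N -> agree m k k' -> `|ut (t, k) - ut (t, k')| < 8^-1.
  by move=> nm kk'; apply: un0; apply: agree_le kk'; exact: leq_trans n0n nm.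
pose K := kseq p n; pose M := kseq p n.+1.
(* the jump is an integer, and it varies by less than 1/4 when j moves by K *)
have cK j : c (j + K)%N = c j.
  have e1 : `|ut (b, seam (j + K)) - ut (b, seam j)| < 8^-1.
    by apply: (un n) => //; apply: agree_of_nat; rewrite modnDr.
  have e2 : `|ut (a, seam (j + K).+1) - ut (a, seam j.+1)| < 8^-1.
    by apply: (un n) => //; apply: agree_of_nat; rewrite -addSn modnDr.
  have : `|(c (j + K)%N)%:~R - (c j)%:~R| < 1 :> R.
    rewrite !cE in e1; move: e1 e2; rewrite !ltr_norml; lra.
  by rewrite -intrB -intr_norm (ltr_int R _ 1); lia.
pose S j : int := \sum_(i < j) c i.
have SS j : S j.+1 = S j + c j by rewrite /S big_ord_recr.
have [r SM] : exists r : int, S M = r * q%:Z.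
  rewrite /S /M /= (sum_periodic _ cK) -mulr_natr; have /dvdnP[s ->] := qpn.
  by exists (S K * s%:Z); rewrite /S -mulrA; congr (_ * _); lia.
have [theta [cth th01 tha thb]] := continuum_parameter R cL ab.
pose delta := ut (a, seam M) - ut (a, seam 0).
have ltdelta : `|delta| < 8^-1.
  by apply: (un n.+1) => //; apply: agree_of_nat; rewrite modnn mod0n.
(* w is the lift of u accumulated along the seam orbit, divided by q. One turn
   of stage n.+1 does not quite bring ut back to its initial value; delta is the
   defect, absorbed by theta on the last copy. *)
pose w (i : nat) t : R :=
  (ut (t, seam i) + (S i)%:~R - delta * (i.+1 == M)%:R * theta t) / q%:R.
have M0 : (0 < M)%N by exact: kseq_gt0.
have q0R : q%:R != 0 :> R by rewrite pnatr_eq0 -lt0n.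
have cw i : continuous (w i).
  apply: mulf_continuous; last exact: cst_continuous.
  apply: addf_continuous.
    apply: addf_continuous; last exact: cst_continuous.
    apply: (comp_continuous (f := fun t => (t, seam i)) (g := ut)) => //.
    by apply: pair_continuous; [move=> ? | exact: cst_continuous].
  apply: oppf_continuous; apply: mulf_continuous => //; exact: cst_continuous.
pose g (i : 'I_M) t := cis (w i t).
have cg i : continuous (g i) by apply: cis_continuous; exact: cw.
have gE i : g i b = g (ordS i) a.
  have wb : w i b = (ut (a, seam i.+1) + (S i.+1)%:~R - delta * (i.+1 == M)%:R) / q%:R.
    by rewrite /w thb cE SS intrD; congr (_ / _); ring.
  have wa m : w m a = (ut (a, seam m) + (S m)%:~R) / q%:R.
    by rewrite /w tha mulr0 subr0.
  rewrite /g wb wa /=.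
  have [iM|iM] := eqVneq i.+1 M.
    rewrite iM modnn SM [S 0%N]big_ord0 mulr1 addr0 /delta.
    have -> : (ut (a, seam M) + (r * q%:Z)%:~R - (ut (a, seam M) - ut (a, seam 0%N))) / q%:R
      = ut (a, seam 0%N) / q%:R + r%:~R.
      by rewrite intrM -pmulrn; field.
    by rewrite cisDint.
  rewrite mulr0 subr0 modn_small// ltn_neqAle iM.
  exact: ltn_ord i.
have v0_neq0 x : circle_fun g (stage n.+1 x) != 0 by exact: cis_neq0.
have cv : continuous (fun x : solenoid L p => to_punctured (v0_neq0 x)).
  apply: to_punctured_continuous.
  apply: (comp_continuous (f := stage n.+1) (g := circle_fun g)).
    exact: stage_continuous.
  exact: (circle_fun_continuous fa lb).
exists (mkcts cv); apply: homotopic_dot => x.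
have [[t k] <-] := flow_surj fa lb ab p_gt0 x.
have -> : set_val ((power q \o mkcts cv) (flow (t, k))) =
    cpow q (g (Ordinal (digits_val_lt n.+1 k)) t).
  by rewrite -(circle_funE fa lb gE).
set i := digits_val n.+1 k.
have hv : has_arg (cpow q (g (Ordinal (digits_val_lt n.+1 k)) t)) (q%:R * w i t).
  by apply: has_arg_cpow; exact: has_arg_cis.
rewrite -cmul_conj_dot.
have := has_arg_mul hv (has_arg_conj (hut (t, k))).
move=> /(has_arg_int (- S i)) /right_has_arg; apply.
have -> : q%:R * w i t - ut (t, k) + (- S i)%:~R =
    (ut (t, seam i) - ut (t, k)) - delta * (i.+1 == M)%:R * theta t.
  by rewrite /w rmorphN/=; field.
have h1 : `|ut (t, seam i) - ut (t, k)| < 8^-1.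
  by apply: (un n.+1) => //; apply: agree_sym; exact: agree_digits_val.
have h2 : `|delta * (i.+1 == M)%:R * theta t| < 8^-1.
  rewrite !normrM; apply: le_lt_trans ltdelta.
  rewrite -mulrA ler_piMr// mulr_ile1//.
    by case: (_ == _); rewrite ?normr1 ?normr0.
  by have /andP[? ?] := th01 t; rewrite ger0_norm.
by apply: le_lt_trans (ler_normB _ _) _; lra.
Qed.

Lemma line_connected : connected [set: R].
Proof. by apply/connected_intervalP. Qed.

(** Homotopic maps differ by a factor whose argument is single valued on the
    solenoid: at a seam the argument may only jump by an integer, which depends
    continuously on the parameter of the homotopy and vanishes at its start. *)
Lemma homotopy_lift (f g : continuousType (solenoid L p) (punctured R)) :
  @homotopic R _ _ f g -> exists w : L * digits p -> R,
    [/\ continuous w,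
        forall z, has_arg (cmul (set_val (g (flow z))) (cconj (set_val (f (flow z))))) (w z) &
        forall j, w (b, seam j) = w (a, seam j.+1)].
Proof.
move=> [H [cH H0 H1]].
pose F (y : R * (L * digits p)) := set_val (H (flow y.2, clamp y.1)).
have cF : continuous F.
  have cfl : continuous (fun y : R * (L * digits p) => (flow y.2, clamp y.1)).
    apply: pair_continuous.
      exact: (comp_continuous snd_continuous (@flow_continuous _ L p)).
    exact: (comp_continuous fst_continuous clamp_continuous).
  have cHc : continuous (fun y : R * (L * digits p) => H (flow y.2, clamp y.1)).
    apply/continuous_subspace_setT.
    apply: (within_continuous_restr cH (continuous_subspaceT cfl)) => // y _.
    by split => //=; rewrite in_itv /= clamp_itv.
  exact: (comp_continuous cHc punctured_val_continuous).
have [|||||| W [cW hW]] := @lift_chain R _ R (L * digits p)%type F 0 1.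
- exact: line_connected.
- by rewrite -setXTT; apply: compact_setX => //; exact: digits_compact.
- exact: cF.
- by move=> z; exact: puncturedP.
- move=> s z s0; rewrite /F /=; congr (set_val (H (_, _))).
  by rewrite /clamp maxxx max_l.
- move=> s z s1; rewrite /F /=; congr (set_val (H (_, _))).
  by rewrite clamp1 /clamp max_r ?min_l// (le_trans _ s1).
have F0 z : F (0, z) = set_val (f (flow z)) by rewrite /F /= clamp0 H0.
have F1 z : F (1, z) = set_val (g (flow z)) by rewrite /F /= clamp1 H1.
have cWs s : continuous (fun z => W (s, z)).
  apply: (comp_continuous (f := fun z => (s, z)) (g := W)) => //.
  by apply: pair_continuous; [exact: cst_continuous | move=> ?].
have cWz z : continuous (fun s => W (s, z)).
  apply: (comp_continuous (f := fun s => (s, z)) (g := W)) => //.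
  by apply: pair_continuous; [move=> ? | exact: cst_continuous].
exists (fun z => W (1, z) - W (0, z)); split.
- by apply: addf_continuous => //; exact: oppf_continuous.
- move=> z; have [m ->] : exists m : int, W (0, z) = m%:~R.
    have h0 : has_arg (cmul (F (0, z)) (cconj (F (0, z)))) 0.
      have [s hs] := has_arg_ex (puncturedP (f (flow z))).
      by rewrite F0 -(subrr s); apply: has_arg_mul => //; exact: has_arg_conj.
    by have [m] := has_arg_uniq (hW (0, z)) h0; rewrite subr0; exists m.
  by rewrite -F0 -F1 -intrN; apply: has_arg_int; exact: hW.
- move=> j.
  have := @int_valued_const R R (fun s => W (s, (b, seam j)) - W (s, (a, seam j.+1))) line_connected.
  move=> /(_ _ _ 1 0) h.
  have : W (1, (b, seam j)) - W (1, (a, seam j.+1)) =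
         W (0, (b, seam j)) - W (0, (a, seam j.+1)).
    apply: h; first by apply: addf_continuous => //; exact: oppf_continuous.
    move=> s; apply: has_arg_uniq (hW (s, (a, seam j.+1))).
    by have := hW (s, (b, seam j)); rewrite /F /= (flow_last fa lb).
  lra.
Qed.

(** The witness u turns once along each copy of L. If it were homotopic to the
    q-th power of v, then following the orbit of 0 until it nearly returns, after
    [kseq p n] copies, u and the q-th power of v would turn equally often. *)
Lemma winding_not_power (q : nat) : (forall n, ~~ (q %| kseq p n)%N) ->
  exists u : continuousType (solenoid L p) (punctured R),
  forall v : continuousType (solenoid L p) (punctured R),
    ~ @homotopic R _ _ (power q \o v) u.
Proof.
move=> qp.
have [theta [cth th01 tha thb]] := continuum_parameter R cL ab.
pose g (i : 'I_(kseq p 0)) t : R * R := cis (theta t).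
have cg i : continuous (g i) by exact: cis_continuous.
have gE i : g i b = g (ordS i) a.
  by rewrite /g thb tha -[1]/(1%:~R) -[X in cis X = _]add0r cisDint.
have u0_neq0 x : circle_fun g (stage 0 x) != 0 by exact: cis_neq0.
have cu : continuous (fun x : solenoid L p => to_punctured (u0_neq0 x)).
  apply: to_punctured_continuous.
  apply: (comp_continuous (f := stage 0) (g := circle_fun g)).
    exact: stage_continuous.
  exact: (circle_fun_continuous fa lb).
exists (mkcts cu) => v /homotopy_lift [w [cw hw wj]].
have hu t k : set_val (mkcts cu (flow (t, k))) = cis (theta t).
  by rewrite -[RHS]/(g (Ordinal (digits_val_lt 0 k)) t) -(circle_funE fa lb gE).
have [vt [cvt hvt]] := flow_lift v.
have [c cE] := lift_jump (f := fun x => set_val (v x)) (conj cvt hvt).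
(* m compares the arguments of u provided by the homotopy and by theta *)
pose m (z : L * digits p) := w z + q%:R * vt z - theta z.1.
have cm : continuous m.
  apply: addf_continuous; first apply: addf_continuous => //.
    by apply: mulf_continuous => //; exact: cst_continuous.
  by apply: oppf_continuous; apply: (comp_continuous fst_continuous cth).
have m_int z : exists n : int, m z = n%:~R.
  case: z => t k.
  apply: (@has_arg_uniq _ (cis (theta t))); last exact: has_arg_cis.
  rewrite -(hu t k).
  exact: has_arg_cancel (hw (t, k)) (has_arg_cpow q (hvt (t, k))).
have mconst k t t' : m (t, k) = m (t', k).
  apply: (int_valued_const (f := fun t => m (t, k))) => //.
  apply: (comp_continuous (f := fun t => (t, k)) (g := m)) => //.
  by apply: pair_continuous; [move=> ? | exact: cst_continuous].
(* theta gains 1 along a copy of L, while v jumps by c j at the seam *)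
have mstep j : m (a, seam j.+1) = m (a, seam j) + 1 - (q%:Z * c j)%:~R.
  rewrite [in RHS](mconst _ a b) /m /= thb tha wj cE intrM -pmulrn; ring.
have msum j : m (a, seam j) = m (a, seam 0) + (j%:Z - q%:Z * \sum_(i < j) c i)%:~R.
  elim: j => [|j IHj]; first by rewrite big_ord0 mulr0 subr0 addr0.
  rewrite mstep IHj big_ord_recr /= mulrDr -[j.+1]addn1 PoszD.
  by rewrite !(intrD, intrN, intrM); ring.
have [n hn] := uniform_lift cm (ltr01 : 0 < 1).
have : `|m (a, seam (kseq p n)) - m (a, seam 0)| < 1.
  by apply: hn; apply: agree_of_nat; rewrite modnn mod0n.
rewrite msum addrAC subrr add0r -intr_norm (ltr_int R _ 1) => h.
have {}h : (kseq p n)%:Z = q%:Z * \sum_(i < kseq p n) c i.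
  by apply/eqP; rewrite -subr_eq0; move: h; lia.
have := qp n; have : (q%:Z %| (kseq p n)%:Z)%Z by rewrite h; exact: dvdz_mulr.
by rewrite dvdzE !absz_nat => ->.
Qed.

End divisibility.

(** * Shape invariance *)

Section shape.
Context {R : realType}.

Definition powers_onto (X : topologicalType) (q : nat) : Prop :=
  forall u : hclass R X (punctured R), exists v : hclass R X (punctured R),
    u = hcomp (\pi_(hclass R (punctured R) (punctured R)) (power q)) v.

Lemma powers_ontoP X q : powers_onto X q <->
  forall u : continuousType X (punctured R),
  exists v : continuousType X (punctured R), @homotopic R _ _ (power q \o v) u.
Proof.
split=> [h u | h u].
  have [v] := h (\pi_(hclass R X (punctured R)) u).
  rewrite -[v]reprK hcompE => /esym/eqmodP/asboolP e.
  by exists (repr v).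
have [v e] := h (repr u); exists (\pi_(hclass R X (punctured R)) v).
by rewrite hcompE -[LHS]reprK; apply/esym/eqmodP/asboolP.
Qed.

Lemma powers_onto_shape (X Y : topologicalType) (q : nat) :
  same_shape R X Y -> powers_onto X q <-> powers_onto Y q.
Proof.
move=> [Phi [Psi /(_ (punctured_Wspace (R := R))) [PhiK PsiK]]].
split=> h u.
- have [v e] := h (Phi punctured_Wspace u).
  exists (Psi punctured_Wspace v).
  by rewrite -[LHS]PhiK e; exact: (@shape_natural _ _ _ Psi punctured_Wspace punctured_Wspace).
- have [v e] := h (Psi punctured_Wspace u).
  exists (Phi punctured_Wspace v).
  by rewrite -[LHS]PsiK e; exact: (@shape_natural _ _ _ Phi punctured_Wspace punctured_Wspace).
Qed.

Lemma hcomp_pullback_natural (X Y W W' : topologicalType)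
    (f : continuousType X Y) (h : hclass R W W') (u : hclass R Y W) :
  hcomp (hcomp h u) (\pi_(hclass R X Y) f) = hcomp h (hcomp u (\pi_(hclass R X Y) f)).
Proof.
elim/quotW: h => h; elim/quotW: u => u.
rewrite (hcompE u h) (hcompE f (h \o u : continuousType Y W')).
rewrite (hcompE f u) (hcompE (u \o f : continuousType X W) h).
by congr (\pi_(hclass R X W') _); apply/continuousEP.
Qed.

Definition pullback (X Y : topologicalType) (f : continuousType X Y) : shape_map R X Y :=
  @ShapeMap R X Y (fun W u => hcomp u (\pi_(hclass R X Y) f))
    (fun W W' h u => hcomp_pullback_natural f h u).

Lemma pullbackK (X Y : topologicalType) (f : continuousType X Y)
    (g : continuousType Y X) (W : Wspace R) :
  cancel g f -> cancel (pullback f W) (pullback g W).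
Proof.
move=> gK; elim/quotW => u /=.
rewrite (hcompE f u) (hcompE g (u \o f : continuousType X W)).
by congr (\pi_(hclass R Y W) _); apply/continuousEP => y /=; rewrite gK.
Qed.

Lemma homeomorphic_same_shape (X Y : topologicalType) :
  homeomorphic X Y -> same_shape R X Y.
Proof.
move=> [f [g [fK gK]]]; exists (pullback f), (pullback g) => W.
by split; exact: pullbackK.
Qed.

Lemma same_shape_refl (X : topologicalType) : same_shape R X X.
Proof. by apply: homeomorphic_same_shape; exists idfun, idfun. Qed.

End shape.

Lemma homeomorphic_refl (X : topologicalType) : homeomorphic X X.
Proof. by exists idfun, idfun. Qed.

(** * Continuum many solenoids *)

Fixpoint prime_seq (n : nat) : nat :=
  if n is n'.+1 then s2val (prime_above (prime_seq n')) else 2.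

Lemma prime_prime_seq n : prime (prime_seq n).
Proof. by case: n => //= n; case: prime_above. Qed.

Lemma prime_seq_inj : injective prime_seq.
Proof.
suff incr : {homo prime_seq : m n / (m < n)%N} by exact: incn_inj (leq_mono incr).
apply: homo_ltn; first by move=> y x z; exact: ltn_trans.
by move=> i /=; case: prime_above.
Qed.

(** Every i is the 2-adic valuation of infinitely many n, which all carry the same
    prime: one of two primes reserved for i, according to whether A contains i. *)
Definition prime_code (A : set nat) (n : nat) : nat :=
  prime_seq ((logn 2 n).*2 + `[< A (logn 2 n) >])%N.

Lemma prime_code_gt1 A n : (1 < prime_code A n)%N.
Proof. exact/prime_gt1/prime_prime_seq. Qed.

Lemma prime_code_dvd A i : A i -> forall N, exists2 n, (N <= n)%N &
  (prime_seq i.*2.+1 %| prime_code A n)%N.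
Proof.
move=> Ai N; exists (2 ^ i * N.*2.+1)%N.
  apply: (@leq_trans N.*2.+1); first by rewrite -addnn; lia.
  by rewrite leq_pmull// expn_gt0.
rewrite /prime_code lognM ?expn_gt0// pfactorK// logn_coprime ?addn0; last first.
  by rewrite coprime2n /= odd_double.
by rewrite (asboolT Ai) addn1.
Qed.

Lemma prime_code_ndvd A i n : ~ A i -> ~~ (prime_seq i.*2.+1 %| kseq (prime_code A) n)%N.
Proof.
move=> nAi; have := prime_prime_seq i.*2.+1.
have : forall m, prime_seq i.*2.+1 != prime_code A m.
  move=> m; apply/eqP => /prime_seq_inj.
  have [Aj|nAj] := asboolP (A (logn 2 m)) => e; last by lia.
  by apply: nAi; have -> : i = logn 2 m by lia.
move: (prime_seq _) => q qA q_prime; elim: n => [|n IHn] /=.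
  by rewrite dvdn1 gtn_eqF// prime_gt1.
rewrite Euclid_dvdM// negb_or IHn andbT dvdn_prime2//.
exact: prime_prime_seq.
Qed.

Lemma card_nat_fun : [set: nat -> nat] #<= [set: set nat].
Proof.
apply/pcard_leTP/injPex; exists (fun f : nat -> nat => [set n | exists i, n = choice.pickle (i, f i)]).
move=> f g _ _ fg; apply/funext => i.
have : [set n | exists i, n = choice.pickle (i, f i)] (choice.pickle (i, f i)) by exists i.
by rewrite fg => -[j] /(pcan_inj choice.pickleK) [-> ->].
Qed.

(** Distinct subsets give inequivalent points of D, and D itself is no larger than
    the set of all sequences. *)
Lemma card_classes (D : set (nat -> nat)) (r : (nat -> nat) -> (nat -> nat) -> Prop)
    (c : set nat -> nat -> nat) :
  (forall p, r p p) -> (forall A, D (c A)) ->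
  (forall A B, r (c A) (c B) -> A = B) -> classes D r #= [set: set nat].
Proof.
move=> rr Dc cr; rewrite card_eq_le; apply/andP; split.
  apply: (card_le_trans (card_image_le _ _)).
  apply: (card_le_trans _ card_nat_fun); exact: subset_card_le.
have inj : {in [set: set nat] &, injective (fun A => [set q | D q /\ r (c A) q])}.
  move=> A B _ _ AB; apply: cr.
  by have [] : [set q | D q /\ r (c A) q] (c B) by rewrite AB.
rewrite -(card_le_eql (inj_card_eq inj)); apply: subset_card_le.
by move=> _ [A _ <-]; exists (c A).
Qed.

Theorem corollary5p9 (R : realType) (d : Order.disp_t)
    (L : orderTopologicalType d) (HL : ordered_continuum L) :
  classes [set p : nat -> nat | forall n, (1 < p n)%N]
    (fun p q => same_shape R (solenoid L p) (solenoid L q)) #= [set: set nat] /\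
  classes [set p : nat -> nat | forall n, (1 < p n)%N]
    (fun p q => homeomorphic (solenoid L p) (solenoid L q)) #= [set: set nat].
Proof.
have [[x [y xy]] cL cnL] := HL.
have [[a fa] [b lb]] := ordered_continuum_ends cL (ex_intro _ x I).
have ab : a != b.
  apply: contra xy => /eqP ab; rewrite eq_le.
  by rewrite (le_trans (lb x))// -?ab//= (le_trans (lb y))// -ab.
have code_gt0 A n : (0 < prime_code A n)%N by exact: ltnW (prime_code_gt1 A n).
have codeP A i : powers_onto (R := R) (solenoid L (prime_code A)) (prime_seq i.*2.+1) <-> A i.
  rewrite powers_ontoP; split=> [onto|Ai].
    apply: contrapT => nAi.
    have [u uP] := winding_not_power fa lb ab cnL cL (code_gt0 A)
      (fun n => prime_code_ndvd n nAi) (R := R).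
    by have [v /uP] := onto u.
  apply: (power_surjective fa lb ab cnL cL (code_gt0 A) _ (prime_code_dvd Ai)).
  exact/prime_gt0/prime_prime_seq.
have shape_inj A B : same_shape R (solenoid L (prime_code A)) (solenoid L (prime_code B)) -> A = B.
  move=> AB; apply/seteqP; split=> i.
    by move/codeP/(powers_onto_shape _ AB)/codeP.
  by move/codeP/(powers_onto_shape _ AB)/codeP.
split.
- apply: (card_classes (c := prime_code)) => //; first by move=> p; exact: same_shape_refl.
  by move=> A n; exact: prime_code_gt1.
- apply: (card_classes (c := prime_code)) => //; first by move=> p; exact: homeomorphic_refl.
    by move=> A n; exact: prime_code_gt1.
  by move=> A B /(homeomorphic_same_shape (R := R)); exact: shape_inj.
Qed.
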